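(* In the regression model $Y_i=f(x_i^{(n)})+\varepsilon_i$, $1\le i\le n$, with B-spline regressors, assume that $f$ is bounded, that $k_n=o\left(\left(\frac{n}{\ln n}\right)^{1/3}\right)$, and that there exist positive constants $C_1,C_2$ such that, as $n$ increases, for any $\theta\in\mathbb{R}^{k_n}$, $$C_1\frac n{k_n}\|\theta\|^2\le\theta^T\Phi^T\Phi\,\theta\le C_2\frac n{k_n}\|\theta\|^2 .$$ Let $\widetilde W=\mathcal{N}(0,I_{k_n})$ be the prior on the spline coefficients $\theta\in\mathbb{R}^{k_n}$. Then $$E\left\|\widetilde W(d\theta\mid Y)-\mathcal{N}\left(\theta_Y,\sigma^2(\Phi^T\Phi)^{-1}\right)\right\|_{\mathrm{TV}}\longrightarrow0\qquad\text{as }n\to\infty,$$ and the convergence rate relative to the Euclidean norm for $\theta$ is $\frac{k_n}{\sqrt n}$: for every sequence $\lambda_n\to\infty$, $$E\left[\widetilde W\left(\|\theta-\theta_0\|\ge\lambda_n\frac{k_n}{\sqrt n}\ \Big|\ Y\right)\right]\longrightarrow0 .$$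
   Context: Model: $\alpha>0$ and $f\in C^\alpha[0,1]$ is a fixed function (i.e. $f$ is $\alpha_0$ times continuously differentiable, $\alpha_0$ the greatest integer less than $\alpha$, with $\sup_{x\ne x'}|f^{(\alpha_0)}(x)-f^{(\alpha_0)}(x')|/|x-x'|^{\alpha-\alpha_0}<\infty$). For a (not necessarily uniform) design $(x_i^{(n)})_{n\ge1,1\le i\le n}$ in $[0,1]$, one observes $Y=(Y_1,\dots,Y_n)$, $Y_i=f(x_i^{(n)})+\varepsilon_i$, with $\varepsilon_i$ i.i.d. $\mathcal{N}(0,\sigma^2)$, $\sigma>0$ known and not depending on $n$. $F_0=(f(x_i^{(n)}))_{1\le i\le n}$; $E$ is expectation under $Y\sim\mathcal{N}(F_0,\sigma^2I_n)$. Regressors: fix an integer $q\ge\alpha$ and let $K=k_n+1-q\ge1$. Partition $(0,1]$ into the $K$ intervals $((j-1)/K,j/K]$, $1\le j\le K$. $(B_j)_{1\le j\le k_n}$ is the usual (normalized, partition of unity) B-spline basis of the $k_n$-dimensional space of splines of order $q$ on this partition, i.e. functions that are polynomials of degree at most $q-1$ on each interval and (if $q\ge2$) $q-2$ times continuously differentiable. $\Phi$ is the $n\times k_n$ matrix with columns $\phi_j=(B_j(x_i^{(n)}))_{1\le i\le n}$, of rank $k_n\le n$. $\theta_Y=(\Phi^T\Phi)^{-1}\Phi^TY$, $\theta_0=(\Phi^T\Phi)^{-1}\Phi^TF_0$. $\widetilde W(\cdot\mid Y)$ is the posterior distribution of $\theta$ when $\theta\sim\widetilde W$ and, conditionally on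 $\theta$, $Y\sim\mathcal{N}(\Phi\theta,\sigma^2I_n)$. $\|\cdot\|$ is the Euclidean norm; $\|Q-Q'\|_{\mathrm{TV}}=\sup_A|Q(A)-Q'(A)|$. *)

(* Defs.v *)
From HB Require Import structures.
From mathcomp Require Import all_boot all_order all_algebra.
From mathcomp Require Import all_classical all_reals all_analysis.
From mathcomp Require Import measurable_realfun.

Set Implicit Arguments.
Unset Strict Implicit.
Unset Printing Implicit Defensive.

Import Order.TTheory GRing.Theory Num.Theory.
Import numFieldNormedType.Exports.

Local Open Scope classical_set_scope.
Local Open Scope ring_scope.

(** * Hölder classes on [[0, 1]] *)

(** [g'] is the derivative of [g] relative to [[0, 1]], hence one-sided at [0]
    and [1]; the values of [g] and [g'] outside [[0, 1]] play no role. *)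
Definition has_deriv01 (R : realType) (g g' : R -> R) : Prop :=
  forall x : R, x \in `[0, 1] ->
    (g y - g x) / (y - x)
      @[y --> within [set y : R | y \in `[0, 1] /\ y != x] (nbhs x)] --> g' x.

(** [a0] is the greatest integer less than [alpha], and [g i] stands for the
    [i]-th derivative of [f]. *)
Definition holder01 (R : realType) (alpha : R) (f : R -> R) : Prop :=
  exists (a0 : nat) (g : nat -> R -> R),
    [/\ a0%:R < alpha <= a0.+1%:R,
        forall x : R, x \in `[0, 1] -> g 0%N x = f x,
        forall i, (i < a0)%N -> has_deriv01 (g i) (g i.+1),
        {within `[0, 1]%classic, continuous (g a0)} &
        exists M : R, forall x x' : R, x \in `[0, 1] -> x' \in `[0, 1] ->
          `|g a0 x - g a0 x'| <= M * `|x - x'| `^ (alpha - a0%:R)].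

(** * B-splines *)

(** Cox-de Boor recursion for the normalized B-splines of order [m.+1] with
    knots [t]; the quotients [0 / 0] produced by repeated knots are [0].
    The cells are [(t j, t j.+1]], except that the first nonempty one also
    contains its left end [t 0]: with the knots below, the B-splines sum to [1]
    on the whole of [[0, 1]] and are right-continuous at [0]. *)
Fixpoint cox_de_boor (R : realType) (t : nat -> R) (m j : nat) (x : R) : R :=
  if m is m'.+1 then
    (x - t j) / (t (j + m'.+1)%N - t j) * cox_de_boor t m' j x +
    (t (j + m'.+2)%N - x) / (t (j + m'.+2)%N - t j.+1) *
      cox_de_boor t m' j.+1 x
  else
    ((t j < x <= t j.+1)
     || [&& x == t 0%N, t j == t 0%N & t j < t j.+1])%:R.

(** Knots [0, 1/K, ..., 1], with multiplicity [q] at both ends (for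
    [i < K + 2 * q - 1]; the later values are not used). *)
Definition knot (R : realType) (q K i : nat) : R :=
  (minn (i - q.-1) K)%:R / K%:R.

Definition bspline (R : realType) (q K j : nat) (x : R) : R :=
  cox_de_boor (knot R q K) q.-1 j x.

Definition bspline_mx (R : realType) (q n k : nat) (x : 'I_n -> R) :
    'M[R]_(n, k) :=
  \matrix_(i < n, j < k) bspline q (k + 1 - q) j (x i).

(** * Euclidean space and least squares *)

Definition colv (R : realType) n (v : n.-tuple R) : 'cV[R]_n :=
  \col_i tnth v i.

Definition enorm (R : realType) n (v : 'cV[R]_n) : R :=
  Num.sqrt (\sum_i v i 0 ^+ 2).

Definition gram (R : realType) n k (Phi : 'M[R]_(n, k)) : 'M[R]_k :=
  Phi^T *m Phi.

Definition lse (R : realType) n k (Phi : 'M[R]_(n, k)) (v : 'cV[R]_n) :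
    'cV[R]_k :=
  invmx (gram Phi) *m Phi^T *m v.

(** * Lebesgue measure on [R^n], realized as [n.-tuple R] *)

Section lebesgue_cons.
Context (R : realType) (n : nat).
Variable mu : {sigma_finite_measure set (n.-tuple R) -> \bar R}.
Local Open Scope ereal_scope.

Let cons_pair (p : measurableTypeR R * n.-tuple R) : n.+1.-tuple R := [tuple of p.1 :: p.2].

Let measurable_cons_pair : measurable_fun setT cons_pair.
Proof. exact: measurable_cons. Qed.

Let leb : {sigma_finite_measure set (measurableTypeR R) -> \bar R} :=
  lebesgue_measure.

Definition lebesgue_cons : set (n.+1.-tuple R) -> \bar R :=
  pushforward (leb \x mu) cons_pair.

Let lc0 : lebesgue_cons set0 = 0.
Proof. by rewrite /lebesgue_cons /pushforward preimage_set0 measure0. Qed.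

Let lc_ge0 A : 0 <= lebesgue_cons A.
Proof. by apply: integral_ge0 => x _ /=; exact: measure_ge0. Qed.

Let lc_sigma_additive : semi_sigma_additive lebesgue_cons.
Proof.
exact: (@measure_semi_sigma_additive _ _ _ (pushforward (leb \x mu) cons_pair)).
Qed.

HB.instance Definition _ :=
  isMeasure.Build _ _ _ lebesgue_cons lc0 lc_ge0 lc_sigma_additive.

Let lc_sigma_finite : sigma_finite setT lebesgue_cons.
Proof.
have /sigma_finiteP[F [TF ndF Foo]] := sigma_finiteT leb.
have /sigma_finiteP[G [TG ndG Goo]] := sigma_finiteT mu.
pose uncons (v : n.+1.-tuple R) := (thead v, [tuple of behead v]).
have unconsK : cancel cons_pair uncons.
  by move=> [x v]; rewrite /uncons theadE; congr (x, _); exact: val_inj.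
have munc : measurable_fun setT uncons.
  apply: measurable_fun_pair; first exact: measurable_tnth.
  exact: measurable_behead.
exists (fun i => uncons @^-1` (F i `*` G i)).
  rewrite -preimage_bigcup -[LHS](preimage_setT uncons); congr (_ @^-1` _).
  apply/esym/seteqP; split => // -[x v] _.
  have [i _ Fix] : (\bigcup_i F i) x by rewrite -TF.
  have [j _ Gjv] : (\bigcup_i G i) v by rewrite -TG.
  exists (maxn i j) => //; split => /=.
  - by move: x Fix; exact/subsetPset/ndF/leq_maxl.
  - by move: v Gjv; exact/subsetPset/ndG/leq_maxr.
move=> i; have [mF Fi] := Foo i; have [mG Gi] := Goo i; split.
  by rewrite -[X in measurable X]setTI; apply: munc => //; exact: measurableX.
rewrite /lebesgue_cons /pushforward -comp_preimage.
have -> : uncons \o cons_pair = id by exact/funext.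
rewrite preimage_id product_measure1E//; apply: lte_mul_pinfty => //.
by rewrite ge0_fin_numE.
Qed.

HB.instance Definition _ :=
  Measure_isSigmaFinite.Build _ _ _ lebesgue_cons lc_sigma_finite.

End lebesgue_cons.

Fixpoint lebesgue_tuple (R : realType) (n : nat) :
    {sigma_finite_measure set (n.-tuple R) -> \bar R} :=
  match n with
  | 0%N => dirac [tuple]
  | n'.+1 => lebesgue_cons (lebesgue_tuple R n')
  end.

(** * Gaussian laws and posterior distributions *)

(** Density of [N(m, S)], for [S] symmetric positive definite. *)
Definition gauss_pdf (R : realType) n (m : 'cV[R]_n) (S : 'M[R]_n)
    (v : 'cV[R]_n) : R :=
  (Num.sqrt ((2 * pi) ^+ n * \det S))^-1 *
  expR (- (((v - m)^T *m invmx S *m (v - m)) 0 0) / 2).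

Section gauss_law.
Context (R : realType) (n : nat) (m : 'cV[R]_n) (S : 'M[R]_n).
Local Open Scope ereal_scope.

Definition gauss_law (A : set (n.-tuple R)) : \bar R :=
  \int[lebesgue_tuple R n]_(v in A) (gauss_pdf m S (colv v))%:E.

Lemma gauss_pdf_ge0 (v : 'cV[R]_n) : (0 <= gauss_pdf m S v)%R.
Proof. by rewrite mulr_ge0 ?expR_ge0// invr_ge0 sqrtr_ge0. Qed.

Lemma measurable_gauss_pdf :
  measurable_fun setT (fun v : n.-tuple R => gauss_pdf m S (colv v)).
Proof.
apply: measurable_funM => //; apply: measurableT_comp => //.
apply: measurable_funM => //; apply: measurableT_comp => //.
have mcoor i : measurable_fun setT (fun v : n.-tuple R => (colv v - m) i 0)%R.
  under eq_fun do rewrite !mxE.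
  by apply: measurable_funB => //; exact: measurable_tnth.
under eq_fun do rewrite mxE.
apply: measurable_sum => j; apply: measurable_funM; last exact: mcoor.
under eq_fun do rewrite mxE.
apply: measurable_sum => i; apply: measurable_funM => //.
under eq_fun do rewrite mxE.
exact: mcoor.
Qed.

Let gauss0 : gauss_law set0 = 0.
Proof. by rewrite /gauss_law integral_set0. Qed.

Let gauss_ge0 A : 0 <= gauss_law A.
Proof. by apply: integral_ge0 => v _; rewrite lee_fin gauss_pdf_ge0. Qed.

Let gauss_sigma_additive : semi_sigma_additive gauss_law.
Proof.
move=> F mF tF mUF; rewrite /gauss_law ge0_integral_bigcup//=; last first.
- by move=> v _; rewrite lee_fin gauss_pdf_ge0.
- apply: measurable_funTS; apply/measurable_EFinP; exact: measurable_gauss_pdf.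
by apply: is_cvg_ereal_nneg_natsum_cond => i _ _; exact: gauss_ge0.
Qed.

HB.instance Definition _ :=
  isMeasure.Build _ _ _ gauss_law gauss0 gauss_ge0 gauss_sigma_additive.

End gauss_law.

(** Bayes' formula for the posterior distribution of [theta] given [Y = y],
    when [theta] has law [W] and [Y] has law [N(Phi theta, sigma^2 I)] given
    [theta]. *)
Definition posterior (R : realType) n k (Phi : 'M[R]_(n, k)) (sigma : R)
    (W : {measure set (k.-tuple R) -> \bar R}) (y : n.-tuple R)
    (A : set (k.-tuple R)) : \bar R :=
  let lik (theta : k.-tuple R) :=
    gauss_pdf (Phi *m colv theta) (sigma ^+ 2)%:M (colv y) in
  ((\int[W]_(theta in A) lik theta) / (\int[W]_theta lik theta))%:E.

Definition tv_dist d (T : measurableType d) (R : realType)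
    (P Q : set T -> \bar R) : \bar R :=
  ereal_sup [set `|P A - Q A|%E | A in measurable].

(* Main.v *)
(** The prior density is bounded and nearly constant at the scale of the
    posterior.  Relative to [Q = N(th, S)], with [th] the least squares estimate
    and [S = sigma^2 (Phi^T Phi)^-1], the posterior has density proportional to
    [u(v) = exp(- <th, h> - |h|^2 / 2)], [h = v - th], so its total variation
    distance to [Q] is at most [2 * int |u - 1| dQ].  The moment generating
    function of [Q] bounds this integral in terms of [<th, S th>] and
    [tr S]; as [Phi^T Phi >= kap I] with [kap = C1 n / k], both are
    [O(k^2 / n)] on average, since [E |th|^2 <= 2 |F0|^2 / kap + O(k / kap)] and
    [|F0|^2 = O(n)].  Finally [k^3 = o(n)] gives [k^2 / n -> 0].  The rate
    follows from the first part and Markov's inequality for [Q].  All Gaussian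
    facts reduce to the value of the Gaussian integral. *)

Require Import Defs.
From mathcomp Require Import all_boot all_order all_algebra.
From mathcomp Require Import all_classical all_reals all_analysis.
From mathcomp Require Import measurable_realfun.
From mathcomp Require Import ring lra.

Set Implicit Arguments.
Unset Strict Implicit.
Unset Printing Implicit Defensive.

Import Order.TTheory GRing.Theory Num.Theory.
Import numFieldNormedType.Exports.

Local Open Scope classical_set_scope.
Local Open Scope ring_scope.

(** * Integrals of nonnegative functions, and measures given by a density *)

Section nonnegative_integrals.
Context d (T : measurableType d) (R : realType).
Local Open Scope ereal_scope.

Import HBNNSimple.

(** Unlike [ge0_le_integral], no measurability is required: the integral of a
    nonnegative function is a supremum over the simple functions below it. *)
Lemma ge0_le_integral_nonmeas (mu : {measure set T -> \bar R})
    (f g : T -> \bar R) :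
  (forall x, 0 <= f x) -> (forall x, f x <= g x) ->
  \int[mu]_x f x <= \int[mu]_x g x.
Proof.
move=> f0 fg; have g0 x : 0 <= g x by exact: le_trans (fg x).
rewrite !ge0_integralTE//; apply: ereal_sup_le => _ [h hf <-].
by exists h => // x; exact: le_trans (fg x).
Qed.

(** On indicators this is the hypothesis on [nu]; additivity extends it to simple functions, and
    monotone convergence along [nnsfun_approx] to [f]. *)
Lemma ge0_integral_density (mu nu : {measure set T -> \bar R}) (p : T -> R)
    (f : T -> \bar R) (A : set T) :
  measurable_fun setT p -> (forall x, (0 <= p x)%R) ->
  (forall B, measurable B -> nu B = \int[mu]_(x in B) (p x)%:E) ->
  measurable A -> measurable_fun A f -> (forall x, 0 <= f x) ->
  \int[nu]_(x in A) f x = \int[mu]_(x in A) (f x * (p x)%:E).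
Proof.
move=> mp p0 nuE mA mf f0.
pose h := nnsfun_approx mA mf.
have mpE (B : set T) : measurable_fun B (EFin \o p).
  by apply: measurable_funTS; exact/measurable_EFinP.
have sfunE n : \int[nu]_(x in A) (h n x)%:E =
    \int[mu]_(x in A) ((h n x)%:E * (p x)%:E).
  have hE x : (h n x)%:E =
      \sum_(y \in range (h n)) (y * \1_(h n @^-1` [set y]) x)%:E.
    by rewrite {1}fimfunE -fsumEFin.
  have mind r : measurable_fun A (fun x => (r * \1_(h n @^-1` [set r]) x)%:E).
    by apply: (measurable_comp measurableT) => //; exact: measurable_funM.
  under eq_integral do rewrite hE.
  rewrite ge0_integral_fsum//; last first.
    by move=> r x _; exact: nnfun_muleindic_ge0.
  under [RHS]eq_integral.
    move=> x _; rewrite hE ge0_mule_fsuml; last first.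
      by move=> r; exact: nnfun_muleindic_ge0.
    over.
  rewrite ge0_integral_fsum//; last 2 first.
  - by move=> r; apply: emeasurable_funM.
  - move=> r x _; apply: mule_ge0; last by rewrite lee_fin.
    exact: nnfun_muleindic_ge0.
  apply: eq_fsbigr => r _.
  under eq_integral do rewrite EFinM.
  rewrite integralZl_indic_nnsfun//.
  under [RHS]eq_integral do rewrite EFinM -muleA.
  (* The scalar [r] leaves the right-hand integral only when [0 <= r]; at negative [r] the level set
     of a nonnegative simple function is empty and both sides vanish. *)
  have [r0|r0] := ltP r 0%R.
    by rewrite preimage_nnfun0// !integral0_eq ?mule0// => x _;
      rewrite indicE in_set0 ?mul0e ?mule0.
  rewrite ge0_integralZl//; last 2 first.
  - by apply: emeasurable_funM => //; exact/measurable_EFinP.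
  - by move=> x _; rewrite mule_ge0 ?lee_fin.
  congr (_ * _); rewrite integral_indic// nuE; last exact: measurableI.
  rewrite setIC integral_mkcondr; apply: eq_integral => x _.
  by rewrite epatch_indic/= muleC.
transitivity (limn (fun n => \int[nu]_(x in A) (h n x)%:E)).
  rewrite -monotone_convergence//.
  - apply: eq_integral => x /[!inE] Ax; apply/esym/cvg_lim => //.
    exact: cvg_nnsfun_approx.
  - by move=> n; apply/measurable_EFinP/measurable_funTS.
  - by move=> n x _; rewrite lee_fin.
  - by move=> x _ a b ab; rewrite lee_fin; exact/lefP/nd_nnsfun_approx.
under eq_fun do rewrite sfunE.
rewrite -monotone_convergence//.
- apply: eq_integral => x /[!inE] Ax; apply/cvg_lim => //.
  by apply: cvgeZr => //; exact: cvg_nnsfun_approx.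
- by move=> n; apply: emeasurable_funM => //; apply/measurable_EFinP/measurable_funTS.
- by move=> n x _; rewrite mule_ge0 ?lee_fin.
- move=> x _ a b ab; rewrite lee_wpmul2r ?lee_fin//.
  exact/lefP/nd_nnsfun_approx.
Qed.

End nonnegative_integrals.

(** * Gaussian integrals *)

Definition qform (R : realType) n (A : 'M[R]_n) (v : 'cV[R]_n) : R :=
  (v^T *m A *m v) 0 0.

Definition dotv (R : realType) n (u v : 'cV[R]_n) : R := (u^T *m v) 0 0.

Definition posdef (R : realType) n (A : 'M[R]_n) : Prop :=
  A^T = A /\ forall v : 'cV[R]_n, v != 0 -> 0 < qform A v.

(** The upper right block is written as the transpose of the lower left one, so this is the usual
    Schur complement of the top left entry when [A] is symmetric. *)
Definition schur_compl (R : realType) n (A : 'M[R]_(1 + n)) : 'M[R]_n :=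
  drsubmx A - (A 0 0)^-1 *: (dlsubmx A *m (dlsubmx A)^T).

(** * Elimination of the first coordinate from a symmetric form *)

Section schur.
Variables (R : realType) (n : nat) (A : 'M[R]_(1 + n)).
Hypothesis Asym : A^T = A.
Let a := A 0 0.
Let b : 'cV[R]_n := dlsubmx A.
Let D : 'M[R]_n := drsubmx A.

Let block_schur : A = block_mx a%:M b^T b D.
Proof.
rewrite -[LHS]submxK; congr block_mx.
  by rewrite [LHS]mx11_scalar /a !mxE; congr (A _ _)%:M; exact: val_inj.
by rewrite trmx_dlsub Asym.
Qed.

(** One step of block elimination: [A] is a unit lower triangular matrix times a block upper
    triangular one with diagonal blocks [a] and [schur_compl A]. *)
Lemma det_schur : a != 0 -> \det A = a * \det (schur_compl A).
Proof.
move=> a0; have AE : A =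
    block_mx 1%:M 0 (a^-1 *: b) 1%:M *m block_mx a%:M b^T 0 (schur_compl A).
  rewrite mulmx_block !mul1mx !mul0mx !addr0 -/a -/b -/D [LHS]block_schur.
  rewrite mul_mx_scalar scalerA divff// scale1r ?addr0.
  by rewrite -scalemxAl addrC subrK.
by rewrite {1}AE det_mulmx det_lblock !det1 det_ublock det_scalar1 !mul1r.
Qed.

(** Completing the square in the first coordinate. *)
Lemma qform_schur (x : R) (w : 'cV[R]_n) : a != 0 ->
  qform A (col_mx x%:M w) =
  a * (x + dotv b w / a) ^+ 2 + qform (schur_compl A) w.
Proof.
move=> a0.
have bw : b^T *m w = (dotv b w)%:M by rewrite [LHS]mx11_scalar.
have wb : w^T *m b = (dotv b w)%:M.
  by rewrite -[LHS]trmxK trmx_mul trmxK bw tr_scalar_mx.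
have Sw : w^T *m schur_compl A *m w =
    w^T *m D *m w - a^-1 *: ((dotv b w) ^+ 2)%:M.
  rewrite mulmxBr mulmxBl; congr (_ - _).
  rewrite -scalemxAr -scalemxAl; congr (_ *: _).
  by rewrite -/b !mulmxA wb -mulmxA bw -scalar_mxM expr2.
rewrite /qform Sw {1}block_schur tr_col_mx tr_scalar_mx mul_row_block.
rewrite mul_row_col !mulmxDl wb -(mulmxA x%:M b^T) bw -!scalar_mxM !mxE /= !mulr1n.
by field.
Qed.

(** [a] is the value of the form at the first basis vector; for the complement, [w] is extended by
    the first coordinate that makes the square in [qform_schur] vanish. *)
Lemma schur_posdef : posdef A -> 0 < a /\ posdef (schur_compl A).
Proof.
move=> [_ Apos].
have a_gt0 : 0 < a.
  have : col_mx 1%:M 0 != 0 :> 'cV[R]_(1 + n).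
    apply/eqP => /colP/(_ 0); rewrite !mxE; case: splitP => // j _.
    by rewrite !mxE ord1 => /eqP; rewrite oner_eq0.
  move=> /Apos; rewrite /qform {1}block_schur tr_col_mx mul_row_block mul_row_col.
  by rewrite !trmx0 !mul0mx !mulmx0 !addr0 trmx1 mul1mx mulmx1 mxE mulr1n.
split=> //; split.
  rewrite /schur_compl linearB /= linearZ /= trmx_mul trmxK.
  by rewrite trmx_drsub Asym.
move=> w w0.
have : col_mx (- (dotv b w / a))%:M w != 0.
  by apply: contraNneq w0 => /eqP; rewrite col_mx_eq0 => /andP[_ /eqP ->].
move=> /Apos; rewrite qform_schur ?gt_eqF// addrC.
by rewrite addNr expr0n mulr0 addr0.
Qed.

End schur.

(** * The Gaussian integral over tuples, by induction on the dimension *)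

Section gaussian_integral.
Variable R : realType.
Local Open Scope ereal_scope.

Lemma integral_normal_fun (m s : R) : s != 0%R ->
  \int[lebesgue_measure]_x (normal_fun m s x)%:E =
  (Num.sqrt (s ^+ 2 * pi *+ 2))%:E.
Proof.
move=> s0; have := integral_normal_pdf m s.
rewrite normal_pdfE// /=.
under eq_integral do rewrite EFinM.
rewrite ge0_integralZl_EFin//; last 3 first.
- by move=> x _; rewrite lee_fin normal_fun_ge0.
- by apply/measurable_EFinP; exact: measurable_normal_fun.
- exact: normal_peak_ge0.
have p0 := normal_peak_gt0 s0.
move=> /(congr1 (fun e => (normal_peak s)^-1%:E * e)).
by rewrite muleA -EFinM mulVf ?gt_eqF// mul1e mule1 => ->; rewrite invrK.
Qed.

Lemma measurable_colv_coor n (i : 'I_n) :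
  measurable_fun setT (fun v : n.-tuple R => colv v i 0%R).
Proof. by under eq_fun do rewrite mxE; exact: measurable_tnth. Qed.

Lemma measurable_dotv_colv n (a m : 'cV[R]_n) :
  measurable_fun setT (fun v : n.-tuple R => dotv a (colv v - m)).
Proof.
rewrite /dotv; under eq_fun do rewrite mxE.
apply: measurable_sum => j; apply: measurable_funM => //.
under eq_fun do rewrite mxE.
by apply: measurable_funD; [exact: measurable_colv_coor|].
Qed.

Lemma measurable_qform_colv n (A : 'M[R]_n) (m : 'cV[R]_n) :
  measurable_fun setT (fun v : n.-tuple R => qform A (colv v - m)).
Proof.
have mcoor i : measurable_fun setT (fun v : n.-tuple R => (colv v - m)%R i 0%R).
  under eq_fun do rewrite mxE.
  by apply: measurable_funD; [exact: measurable_colv_coor|].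
rewrite /qform; under eq_fun do rewrite mxE.
apply: measurable_sum => j; apply: measurable_funM => //.
under eq_fun do rewrite mxE.
apply: measurable_sum => i; apply: measurable_funM => //.
under eq_fun do rewrite mxE.
exact: mcoor.
Qed.

Lemma measurable_expR_qform_colv n (A : 'M[R]_n) (m : 'cV[R]_n) :
  measurable_fun setT
    (fun v : n.-tuple R => (expR (- qform A (colv v - m) / 2))%:E).
Proof.
apply/measurable_EFinP; apply: measurableT_comp => //.
apply: measurable_funM => //; apply: measurableT_comp => //.
exact: measurable_qform_colv.
Qed.

Lemma colv_cons n (x : R) (v : n.-tuple R) :
  colv [tuple of x :: v] = col_mx x%:M%R (colv v).
Proof.
apply/colP => i; rewrite [LHS]mxE; case: (@split_ordP 1 n i) => j ->.
  by rewrite (@col_mxEu _ 1 n 1) [j]ord1 !mxE mulr1n.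
by rewrite (@col_mxEd _ 1 n 1) !mxE !(tnth_nth x).
Qed.

(** The measure is the image of a product under consing, so this is Tonelli's theorem with the first
    coordinate integrated innermost. *)
Lemma integral_lebesgue_cons n (F : n.+1.-tuple R -> \bar R) :
  measurable_fun setT F -> (forall v, 0 <= F v) ->
  \int[lebesgue_tuple R n.+1]_v F v =
  \int[lebesgue_tuple R n]_w
    \int[lebesgue_measure]_x F [tuple of x :: w].
Proof.
move=> mF F0.
pose c (p : measurableTypeR R * n.-tuple R) : n.+1.-tuple R :=
  [tuple of p.1 :: p.2].
have mc : measurable_fun setT c by exact: measurable_cons.
have F0' : {in setT, forall v, 0 <= F v} by move=> v _; exact: F0.
have := ge0_integral_pushforward mc (lebesgue_measure \x lebesgue_tuple R n)
  measurableT mF F0'.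
rewrite preimage_setT => pushE.
transitivity (\int[lebesgue_measure \x lebesgue_tuple R n]_p F (c p)).
  by rewrite -[RHS]pushE; exact: eq_measure_integral.
by rewrite fubini_tonelli2//; exact: measurableT_comp.
Qed.

(** Integrating out one coordinate replaces the precision matrix by its Schur
    complement. *)
Lemma integral_expR_qform n (A : 'M[R]_n) (m : 'cV[R]_n) : posdef A ->
  (0 < \det A)%R /\
  \int[lebesgue_tuple R n]_v (expR (- qform A (colv v - m) / 2))%:E =
  (Num.sqrt ((2 * pi) ^+ n / \det A))%:E.
Proof.
elim: n A m => [|n IH] A m [Asym Apos].
  (* In dimension 0 the measure is a Dirac mass and the form is an empty sum, so both sides are
     1. *)
  rewrite det_mx00; split=> //; rewrite integral_dirac//=.
    rewrite [X in X * _](_ : _ = 1); last exact: diracT.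
    rewrite mul1e.
    by rewrite /qform mxE big_ord0 oppr0 mul0r expR0 expr0 divr1 sqrtr1.
  exact: measurable_expR_qform_colv.
have [a_gt0 Spos] := @schur_posdef R n A Asym (conj Asym Apos).
pose m0 : R := m 0%R 0%R; pose m1 : 'cV[R]_n := dsubmx (m : 'cV[R]_(1 + n)).
have mE : m = col_mx m0%:M m1.
  apply/esym/colP => i; case: (@split_ordP 1 n i) => j ->.
    rewrite (@col_mxEu _ 1 n 1) [j]ord1 mxE mulr1n /m0; congr (m _ _); exact: val_inj.
  by rewrite (@col_mxEd _ 1 n 1) mxE.
set a : R := A 0%R 0%R in a_gt0 *.
have [dS iS] := IH _ m1 Spos.
have an0 : a != 0%R by rewrite gt_eqF.
rewrite (@det_schur R n A Asym an0) -/a; split; first exact: mulr_gt0.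
rewrite integral_lebesgue_cons//; last first.
  exact: measurable_expR_qform_colv.
(* [a^-1] is the conditional variance of the first coordinate given the others: by [qform_schur] the
   integrand is, in that coordinate, a multiple of a one-dimensional normal function with standard
   deviation [s]. *)
pose s : R := Num.sqrt a^-1.
have s2 : (s ^+ 2 = a^-1)%R by rewrite sqr_sqrtr// invr_ge0 ltW.
have s0 : s != 0%R by rewrite gt_eqF// sqrtr_gt0 invr_gt0.
under eq_integral.
  move=> w _.
  under eq_integral.
    move=> x _.
    have -> : expR (- qform A (colv [tuple of x :: w] - m) / 2) =
        (expR (- qform (schur_compl A) (colv w - m1) / 2) *
        normal_fun (m0 - dotv (dlsubmx (A : 'M[R]_(1 + n))) (colv w - m1) / a) s x)%R.
      rewrite colv_cons mE (@opp_col_mx _ 1 n 1) (@add_col_mx _ 1 n 1) -raddfB/=.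
      rewrite (@qform_schur R n A Asym)// /normal_fun -expRD; congr expR.
      by rewrite s2 -/a; field.
    rewrite EFinM; over.
  rewrite ge0_integralZl_EFin//; last 2 first.
  - by move=> x _; rewrite lee_fin normal_fun_ge0.
  - by apply/measurable_EFinP; exact: measurable_normal_fun.
  rewrite integral_normal_fun// s2 muleC; over.
rewrite ge0_integralZl_EFin//; last exact: measurable_expR_qform_colv.
rewrite iS -EFinM -sqrtrM; last first.
  by rewrite mulrn_wge0// mulr_ge0 ?pi_ge0// invr_ge0 ltW.
congr (Num.sqrt _)%:E; rewrite exprS.
by field; rewrite an0 gt_eqF.
Qed.

End gaussian_integral.

(** * Moments of Gaussian laws *)

Section dotv_theory.
Variables (R : realType) (n : nat).
Implicit Types (u v w : 'cV[R]_n) (A : 'M[R]_n) (c : R).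

Lemma dotvE u v : dotv u v = \sum_i u i 0 * v i 0.
Proof. by rewrite /dotv mxE; apply: eq_bigr => i _; rewrite mxE. Qed.

Lemma dotvC u v : dotv u v = dotv v u.
Proof. by rewrite !dotvE; apply: eq_bigr => i _; rewrite mulrC. Qed.

Lemma dotvDr u v w : dotv u (v + w) = dotv u v + dotv u w.
Proof. by rewrite /dotv mulmxDr mxE. Qed.

Lemma dotvNr u v : dotv u (- v) = - dotv u v.
Proof. by rewrite /dotv mulmxN mxE. Qed.

Lemma dotvBr u v w : dotv u (v - w) = dotv u v - dotv u w.
Proof. by rewrite dotvDr dotvNr. Qed.

Lemma dotvDl u v w : dotv (u + v) w = dotv u w + dotv v w.
Proof. by rewrite dotvC dotvDr ![dotv w _]dotvC. Qed.

Lemma dotvNl u v : dotv (- u) v = - dotv u v.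
Proof. by rewrite dotvC dotvNr dotvC. Qed.

Lemma dotvBl u v w : dotv (u - v) w = dotv u w - dotv v w.
Proof. by rewrite dotvDl dotvNl. Qed.

Lemma dotvZr c u v : dotv u (c *: v) = c * dotv u v.
Proof. by rewrite /dotv -scalemxAr mxE. Qed.

Lemma dotvZl c u v : dotv (c *: u) v = c * dotv u v.
Proof. by rewrite dotvC dotvZr dotvC. Qed.

Lemma dotv_ge0 u : 0 <= dotv u u.
Proof. by rewrite dotvE sumr_ge0// => i _; rewrite -expr2 sqr_ge0. Qed.

Lemma dotv_gt0 u : u != 0 -> 0 < dotv u u.
Proof.
move=> u0; rewrite lt0r dotv_ge0 andbT; apply: contraNneq u0 => uu0.
apply/eqP/colP => i; rewrite mxE; apply/eqP; rewrite -sqrf_eq0 expr2.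
move: uu0; rewrite dotvE => /psumr_eq0P -> // j _.
by rewrite -expr2 sqr_ge0.
Qed.

Lemma sqr_enorm u : enorm u ^+ 2 = dotv u u.
Proof.
rewrite /enorm sqr_sqrtr; last by apply: sumr_ge0 => i _; exact: sqr_ge0.
by rewrite dotvE; apply: eq_bigr => i _; rewrite expr2.
Qed.

Lemma qformE A u : qform A u = dotv u (A *m u).
Proof. by rewrite /qform /dotv mulmxA. Qed.

Lemma qformB A u v : A^T = A ->
  qform A (u - v) = qform A u - 2 * dotv u (A *m v) + qform A v.
Proof.
move=> As; rewrite !qformE mulmxBr !dotvBr !dotvBl.
have -> : dotv v (A *m u) = dotv u (A *m v).
  by rewrite [RHS]dotvC /dotv trmx_mul As mulmxA.
by ring.
Qed.

Lemma qform_ge0 A u : posdef A -> 0 <= qform A u.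
Proof.
move=> [_ Apos]; have [->|u0] := eqVneq u 0; last exact/ltW/Apos.
by rewrite qformE mulmx0 /dotv mulmx0 mxE.
Qed.

Lemma qformZr A c u : qform A (c *: u) = c ^+ 2 * qform A u.
Proof. by rewrite !qformE -scalemxAr dotvZl dotvZr mulrA. Qed.

Lemma qformZl c A u : qform (c *: A) u = c * qform A u.
Proof. by rewrite !qformE -scalemxAl dotvZr. Qed.

(** Positivity is carried along the induction that evaluates the Gaussian integral. *)
Lemma det_posdef_gt0 A : posdef A -> 0 < \det A.
Proof. by move=> /(integral_expR_qform 0)[]. Qed.

Lemma posdef_unitmx A : posdef A -> A \in unitmx.
Proof. by move=> /det_posdef_gt0 A0; rewrite unitmxE unitfE gt_eqF. Qed.

Lemma posdef_invmx A : posdef A -> posdef (invmx A).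
Proof.
move=> Apos; have Au := posdef_unitmx Apos; move: (Apos) => [As A0].
have iAs : (invmx A)^T = invmx A by rewrite trmx_inv As.
split=> // v v0; suff -> : qform (invmx A) v = qform A (invmx A *m v).
  by apply: A0; apply: contraNneq v0 => /(congr1 (mulmx A)); rewrite mulKVmx// mulmx0 => ->.
by rewrite !qformE mulKVmx// dotvC.
Qed.

Lemma posdefZ c A : 0 < c -> posdef A -> posdef (c *: A).
Proof.
move=> c0 [As A0]; split; first by rewrite linearZ /= As.
by move=> v /A0 v0; rewrite qformZl mulr_gt0.
Qed.

Lemma posdef1 : posdef (1%:M : 'M[R]_n).
Proof.
by split; [exact: trmx1|move=> v v0; rewrite qformE mul1mx dotv_gt0].
Qed.

End dotv_theory.

Lemma measurable_sqnorm_colv (R : realType) n (m : 'cV[R]_n) :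
  measurable_fun setT
    (fun v : n.-tuple R => dotv (colv v - m) (colv v - m)).
Proof.
under eq_fun do rewrite -[X in dotv _ X]mul1mx -qformE.
exact: measurable_qform_colv.
Qed.

(** Lets the moment generating function control second moments. Both sides are even, and for
    [0 <= x] the quadratic term of the exponential series suffices. *)
Lemma sqr_le_expR (R : realType) (x : R) : x ^+ 2 <= 2 * (expR x + expR (- x)).
Proof.
wlog x0 : x / 0 <= x => [hw|].
  have [/hw//|x0] := leP 0 x.
  by rewrite -sqrrN addrC -{3}[x]opprK; apply: hw; lra.
have := @expR_ge1Dxn R x 1 x0; have := expR_ge0 (- x).
by rewrite (_ : (2`!)%:R = 2 :> R)// => h1 h2; lra.
Qed.

Section gauss_law_theory.
Variables (R : realType) (n : nat) (m : 'cV[R]_n) (S : 'M[R]_n).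
Local Open Scope ereal_scope.

Lemma ge0_integral_gauss_law (f : n.-tuple R -> \bar R) (A : set (n.-tuple R)) :
  measurable A -> measurable_fun A f -> (forall v, 0 <= f v) ->
  \int[gauss_law m S]_(v in A) f v =
  \int[lebesgue_tuple R n]_(v in A) (f v * (gauss_pdf m S (colv v))%:E).
Proof.
move=> mA mf f0; apply: ge0_integral_density => //.
- exact: measurable_gauss_pdf.
- by move=> v; exact: gauss_pdf_ge0.
Qed.

Hypothesis Spos : posdef S.

Lemma gauss_law_setT : gauss_law m S setT = 1.
Proof.
have [dS iS] := integral_expR_qform m (posdef_invmx Spos).
have dS0 := det_posdef_gt0 Spos.
rewrite /gauss_law /gauss_pdf.
under eq_integral do rewrite EFinM.
rewrite ge0_integralZl_EFin//; last exact: measurable_expR_qform_colv.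
rewrite [X in _ * X]iS -EFinM det_inv invrK mulVf// gt_eqF// sqrtr_gt0.
by rewrite mulr_gt0// exprn_gt0// mulr_gt0// pi_gt0.
Qed.

(** Exponential tilting: completing the square moves the mean by [S *m a] and leaves the covariance
    unchanged. *)
Lemma expR_dotv_gauss_pdf (a v : 'cV[R]_n) :
  (expR (dotv a (v - m)) * gauss_pdf m S v =
  expR (qform S a / 2) * gauss_pdf (m + S *m a) S v)%R.
Proof.
rewrite /gauss_pdf mulrCA [RHS]mulrCA; congr (_ * _)%R.
rewrite -!expRD; congr expR.
rewrite -!/(qform _ _) opprD addrA [in RHS]qformB; last first.
  by case: (posdef_invmx Spos).
rewrite mulKmx ?posdef_unitmx//.
have -> : qform (invmx S) (S *m a) = qform S a.
  by rewrite !qformE mulKmx ?posdef_unitmx// dotvC.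
by rewrite [dotv a _]dotvC; field.
Qed.

End gauss_law_theory.

Section gauss_law_moments.
Variables (R : realType) (n : nat) (m : 'cV[R]_n) (S : 'M[R]_n).
Hypothesis Spos : posdef S.
Local Open Scope ereal_scope.

(** After tilting, only the total mass of the law with mean [m + S *m a] remains to be
    integrated. *)
Lemma gauss_law_mgf (a : 'cV[R]_n) :
  \int[gauss_law m S]_v (expR (dotv a (colv v - m)))%:E =
  (expR (qform S a / 2))%:E.
Proof.
rewrite ge0_integral_gauss_law//; last first.
  by apply/measurable_EFinP; apply: measurableT_comp => //; exact: measurable_dotv_colv.
under eq_integral do rewrite -EFinM (expR_dotv_gauss_pdf m Spos) EFinM.
rewrite ge0_integralZl_EFin//; last 2 first.
- by move=> v _; rewrite lee_fin gauss_pdf_ge0.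
- by apply/measurable_EFinP; exact: measurable_gauss_pdf.
have := gauss_law_setT (m + S *m a) Spos.
by rewrite {1}/gauss_law => ->; rewrite mule1.
Qed.

Lemma measurable_sqr_dotv_colv (a b : 'cV[R]_n) :
  measurable_fun setT (fun v : n.-tuple R => ((dotv a (colv v - b)) ^+ 2)%:E).
Proof.
apply/measurable_EFinP; apply: measurable_funX; exact: measurable_dotv_colv.
Qed.

Lemma measurable_expR_dotv_colv (a b : 'cV[R]_n) :
  measurable_fun setT (fun v : n.-tuple R => (expR (dotv a (colv v - b)))%:E).
Proof.
apply/measurable_EFinP; apply: measurableT_comp => //; exact: measurable_dotv_colv.
Qed.

(** The second moment is read off the moment generating function at [a] scaled
    to unit variance. *)
Lemma gauss_law_second_moment (a : 'cV[R]_n) (w : R) :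
  (0 < w)%R -> (qform S a <= w)%R ->
  \int[gauss_law m S]_v ((dotv a (colv v - m)) ^+ 2)%:E <= (8 * w)%:E.
Proof.
move=> w0 aw.
(* The form at [s *: a] is at most 1, so each of the two exponential moments is at most
   [expR 2^-1 <= 2]; the constant 8 is [2 * (2 + 2)]. *)
pose s : R := ((Num.sqrt w)^-1)%R.
have s2 : (s ^+ 2 = w^-1)%R by rewrite exprVn sqr_sqrtr// ltW.
pose b := (s *: a)%R.
have mgf (c : R) : (c ^+ 2 = 1)%R -> \int[gauss_law m S]_v
    (expR (dotv (c *: b)%R (colv v - m)))%:E <= 2%:E.
  move=> c2; rewrite gauss_law_mgf// lee_fin !qformZr c2 mul1r s2.
  have : (w^-1 * qform S a <= 1)%R by rewrite ler_pdivrMl// mulr1.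
  set t := (_ * qform _ _)%R => t1.
  apply: (@le_trans _ _ (expR 2^-1)).
    by rewrite ler_expR ler_piMl// invr_ge0.
  (* Inverting turns [expR 2^-1 <= 2] into the tangent bound [1 - 2^-1 <= expR (- 2^-1)]. *)
  rewrite -[leRHS]invrK -[leLHS]invrK -expRN lef_pV2 ?posrE ?invr_gt0 ?expR_gt0//.
  by have := @expR_ge1Dx R (- 2^-1); lra.
apply: (@le_trans _ _ (\int[gauss_law m S]_v ((2 * w)%:E *
    ((expR (dotv (1 *: b)%R (colv v - m)))%:E +
     (expR (dotv (-1 *: b)%R (colv v - m)))%:E)))).
  apply: ge0_le_integral_nonmeas => v; first by rewrite lee_fin sqr_ge0.
  rewrite -EFinD -EFinM lee_fin scale1r scaleN1r dotvNl dotvZl.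
  rewrite -/s; have := sqr_le_expR (s * dotv a (colv v - m)).
  rewrite exprMn s2 ler_pdivrMl//; lra.
rewrite ge0_integralZl_EFin//; last 3 first.
- by move=> v _; rewrite adde_ge0.
- by apply: emeasurable_funD; exact: measurable_expR_dotv_colv.
- by rewrite mulr_ge0// ltW.
rewrite ge0_integralD//; [|exact: measurable_expR_dotv_colv..].
apply: (@le_trans _ _ ((2 * w)%:E * (2%:E + 2%:E))).
  apply: lee_wpmul2l; first by rewrite lee_fin mulr_ge0// ltW.
  by apply: leeD; apply: mgf; rewrite ?expr1n ?sqrrN ?expr1n.
by rewrite -EFinD -EFinM lee_fin; lra.
Qed.

(** [qform S (row i B)^T] is the [i]-th diagonal entry of the covariance
    [B S B^T] of [B (colv v - m)]. *)
Lemma gauss_law_norm_moment k (B : 'M[R]_(k, n)) (w : R) :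
  (0 < w)%R -> (forall i, qform S (row i B)^T <= w)%R ->
  \int[gauss_law m S]_v (dotv (B *m (colv v - m)) (B *m (colv v - m)))%:E
  <= (8 * w *+ k)%:E.
Proof.
move=> w0 Bw.
have dE (v : n.-tuple R) : (dotv (B *m (colv v - m)) (B *m (colv v - m)))%:E =
    \sum_(i < k) ((dotv (row i B)^T (colv v - m)) ^+ 2)%:E.
  rewrite sumEFin dotvE; congr (_%:E); apply: eq_bigr => i _.
  by rewrite -expr2; congr (_ ^+ 2)%R; rewrite /dotv trmxK -row_mul [RHS]mxE.
under eq_integral do rewrite dE.
rewrite ge0_integral_sum//; last 2 first.
- by move=> i; exact: measurable_sqr_dotv_colv.
- by move=> i v _; rewrite lee_fin sqr_ge0.
apply: (@le_trans _ _ (\sum_(i < k) (8 * w)%:E)).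
  by apply: lee_sum => i _; exact: gauss_law_second_moment.
by rewrite sumEFin sumr_const card_ord.
Qed.

End gauss_law_moments.

(** * Normalized reweighting of a law *)

Section reweighting.
Context d (T : measurableType d) (R : realType).
Variable Q : {measure set T -> \bar R}.
Hypothesis Q1 : Q setT = 1%E.
Variables (u : T -> R) (delta : R).
Hypothesis mu : measurable_fun setT u.
Hypothesis u0 : forall x, 0 <= u x.
Hypothesis udelta : (\int[Q]_x (`|u x - 1|)%:E <= delta%:E)%E.

Let N (A : set T) : R := \int[Q]_(x in A) u x.

Let mud : measurable_fun setT (fun x => `|u x - 1|).
Proof. by apply: measurableT_comp => //; exact: measurable_funB. Qed.

Let Q_le1 A : measurable A -> (Q A <= 1)%E.
Proof. by move=> mA; rewrite -Q1 le_measure// inE. Qed.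

Let Q_fin A : measurable A -> Q A \is a fin_num.
Proof. by move=> mA; rewrite ge0_fin_numE// (le_lt_trans (Q_le1 mA))// ltry. Qed.

(** Integrates [u <= 1 + |u - 1|] and [1 <= u + |u - 1|] over [A]. Stated in extended reals, it also
    yields the finiteness of the integral of [u]. *)
Let int_le A : measurable A ->
  (\int[Q]_(x in A) (u x)%:E <= Q A + delta%:E /\
   Q A <= \int[Q]_(x in A) (u x)%:E + delta%:E)%E.
Proof.
move=> mA.
have mE (f : T -> R) : measurable_fun setT f -> measurable_fun A (EFin \o f).
  by move=> mf; apply: measurable_funTS; exact/measurable_EFinP.
have dA : (\int[Q]_(x in A) (`|u x - 1|)%:E <= delta%:E)%E.
  apply: le_trans udelta; apply: ge0_subset_integral => //.
  exact/measurable_EFinP.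
split.
  apply: (@le_trans _ _ (\int[Q]_(x in A) (1 + (`|u x - 1|)%:E)))%E.
    apply: ge0_le_integral => //.
    - by move=> x _; rewrite lee_fin.
    - exact: mE.
    - by apply: emeasurable_funD => //; exact: mE.
    - move=> x _; rewrite -EFinD lee_fin -lerBlDl; exact: ler_norm.
  rewrite ge0_integralD//; last exact: mE.
  by rewrite integral_cst// mul1e leeD2l.
apply: (@le_trans _ _ (\int[Q]_(x in A) ((u x)%:E + (`|u x - 1|)%:E)))%E.
  rewrite -[leLHS]mul1e -integral_cst//; apply: ge0_le_integral => //.
  - by apply: emeasurable_funD; exact: mE.
  - move=> x _; rewrite -EFinD lee_fin -lerBlDl -normrN opprB; exact: ler_norm.
rewrite ge0_integralD//; last 3 first.
- by move=> x _; rewrite lee_fin.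
- exact: mE.
- exact: mE.
by rewrite leeD2l.
Qed.

Let int_fin A : measurable A -> (\int[Q]_(x in A) (u x)%:E \is a fin_num)%E.
Proof.
move=> mA; rewrite ge0_fin_numE; last by apply: integral_ge0 => x _; rewrite lee_fin.
apply: le_lt_trans (int_le mA).1 _.
by rewrite lte_add_pinfty ?ltry// -ge0_fin_numE// Q_fin.
Qed.

Let N_near A : measurable A -> `|N A - fine (Q A)| <= delta.
Proof.
move=> mA; have [h1 h2] := int_le mA.
move: h1 h2; rewrite -(fineK (int_fin mA)) -(fineK (Q_fin mA)) -!EFinD !lee_fin.
rewrite -[fine (integral _ _ _)]/(N A) => h1 h2.
by rewrite ler_norml; apply/andP; split; lra.
Qed.

Let N_ge0 A : 0 <= N A.
Proof. by apply: Rintegral_ge0. Qed.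

Let N_le A : measurable A -> N A <= N setT.
Proof.
move=> mA; rewrite /N /Rintegral fine_le ?int_fin//.
apply: ge0_subset_integral => //; first exact/measurable_EFinP.
by move=> x _; rewrite lee_fin.
Qed.

Lemma normalized_weight_le1 A : measurable A -> 0 <= N A / N setT <= 1.
Proof.
(* If the total weight vanishes, the quotient is 0 by the convention for division. *)
move=> mA; rewrite divr_ge0//=; have [->|n0] := eqVneq (N setT) 0.
  by rewrite invr0 mulr0.
by rewrite ler_pdivrMr ?mul1r ?N_le// lt0r n0 N_ge0.
Qed.

(** With [r] the quotient, the error is [r * (1 - N setT) + (N A - fine (Q A))]. As [r] lies in the
    unit interval, each term is at most [delta]: one for the mass of [A], one for the
    normalization. *)
Lemma normalized_weight_near A : measurable A ->
  `|N A / N setT - fine (Q A)| <= 2 * delta.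
Proof.
move=> mA; have := N_near mA; have := N_near measurableT.
rewrite Q1 /= => dT dA.
have d0 : 0 <= delta by exact: le_trans dT.
have [NT0|NT0] := eqVneq (N setT) 0.
  have NA0 : N A = 0 by apply/eqP; rewrite eq_le N_ge0 -NT0 N_le.
  by move: dA; rewrite NA0 mul0r => /le_trans; apply; lra.
have /andP[r0 r1] := normalized_weight_le1 mA.
have NTA : N A = N A / N setT * N setT by rewrite divfK.
set r := N A / N setT in r0 r1 NTA *.
have -> : r - fine (Q A) = r * (1 - N setT) + (N A - fine (Q A)).
  by rewrite NTA; ring.
apply: le_trans (ler_normD _ _) _.
rewrite mulr_natl mulr2n lerD// normrM ger0_norm// -normrN opprB.
by apply: le_trans dT; rewrite ler_piMl.
Qed.

End reweighting.

(** * The prior as a weight on the Gaussian law: distance of the weight from 1 *)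

Section tilted_gaussian.
Variables (R : realType) (k : nat) (m : 'cV[R]_k) (S : 'M[R]_k).
Hypothesis Spos : posdef S.

(** The standard normal density at [v] divided by its value at [m]. *)
Definition gauss_tilt (v : k.-tuple R) : R :=
  let h := colv v - m in expR (- dotv m h - dotv h h / 2).

Lemma measurable_gauss_tilt : measurable_fun setT gauss_tilt.
Proof.
apply: measurableT_comp => //; apply: measurable_funB.
  apply: measurableT_comp => //; exact: measurable_dotv_colv.
by apply: measurable_funM => //; exact: measurable_sqnorm_colv.
Qed.

Local Open Scope ereal_scope.

(** The linear factor of [gauss_tilt]; the remaining factor is [expR (- h^2 / 2)], with [h^2] the
    squared norm of [colv v - m]. *)
Let e (v : k.-tuple R) : R := expR (dotv (- m) (colv v - m)).

Let me_sub1 : measurable_fun setT (fun v => ((e v - 1) ^+ 2)%:E).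
Proof.
apply/measurable_EFinP; apply: measurable_funX; apply: measurable_funB => //.
by apply: measurableT_comp => //; exact: measurable_dotv_colv.
Qed.

(** Integrating [(e - 1)^2 + 2 e = e^2 + 1], whose terms are all nonnegative, gives the value
    [expR (2 q) - 2 expR (q / 2) + 1] with [q = qform S m]. It is at most
    [expR (2 q) - 1 <= 2 w / (1 - 2 w)], hence at most [4 w] as [w <= 1/4]. *)
Lemma gauss_law_sqr_expR_sub1 (w : R) : (qform S m <= w <= 4^-1)%R ->
  \int[gauss_law m S]_v ((e v - 1) ^+ 2)%:E <= (4 * w)%:E.
Proof.
move=> /andP[mw w4].
have qN c : qform S (c *: - m) = (c ^+ 2 * qform S m)%R.
  by rewrite -scaleN1r scalerA qformZr mulrN1 sqrrN.
have i1 : \int[gauss_law m S]_v (e v)%:E = (expR (qform S m / 2))%:E.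
  by rewrite gauss_law_mgf// -[(- m)%R]scale1r qN expr1n mul1r.
have i2 : \int[gauss_law m S]_v (expR (dotv (2 *: - m)%R (colv v - m)))%:E =
    (expR (2 * qform S m))%:E.
  by rewrite gauss_law_mgf// qN; congr (expR _)%:E; field.
have : \int[gauss_law m S]_v (((e v - 1) ^+ 2)%:E + 2%:E * (e v)%:E) =
    (expR (2 * qform S m) + 1)%:E.
  transitivity (\int[gauss_law m S]_v
      ((expR (dotv (2 *: - m)%R (colv v - m)))%:E + 1)).
    apply: eq_integral => v _; rewrite -EFinM -!EFinD; congr (_%:E).
    have -> : expR (dotv (2 *: - m)%R (colv v - m)) = (e v * e v)%R.
      by rewrite dotvZl mulr_natl mulr2n expRD.
    by ring.
  rewrite ge0_integralD//; last exact: measurable_expR_dotv_colv.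
  by rewrite i2 integral_cst// [X in _ + 1 * X]gauss_law_setT// mule1 -EFinD.
rewrite ge0_integralD//; last 3 first.
- by move=> v _; rewrite lee_fin sqr_ge0.
- by move=> v _; rewrite mule_ge0// lee_fin expR_ge0.
- by apply: emeasurable_funM => //; exact: measurable_expR_dotv_colv.
rewrite ge0_integralZl_EFin//; last 2 first.
- by move=> v _; rewrite lee_fin expR_ge0.
- exact: measurable_expR_dotv_colv.
rewrite i1 -EFinM; case: (integral _ _ _) => [I|//|//].
rewrite -EFinD => -[] IE; rewrite lee_fin.
have q0 := qform_ge0 m Spos.
have e1 : (1 <= expR (qform S m / 2))%R by rewrite -expR0 ler_expR divr_ge0.
have e2 : (expR (2 * qform S m) * (1 - 2 * w) <= 1)%R.
  rewrite -[leRHS](expRxMexpNx_1 (2 * qform S m)) ler_pM2l ?expR_gt0//.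
  by apply: le_trans (expR_ge1Dx _); lra.
nra.
Qed.

(** With [p] the quadratic factor, [|e p - 1| <= |e - 1| + (1 - p)], and [1 - p] is at most half the
    squared norm. A free [t] trades the first moment of [|e - 1|] for its second. *)
Lemma gauss_tilt_near1 (t w b : R) : (0 < t)%R -> (qform S m <= w <= 4^-1)%R ->
  \int[gauss_law m S]_v (dotv (colv v - m) (colv v - m))%:E <= b%:E ->
  \int[gauss_law m S]_v (`|gauss_tilt v - 1|)%:E <=
  (t / 2 + (2 * w / t) + b / 2)%:E.
Proof.
move=> t0 mw hb.
have mh : measurable_fun setT
    (fun v : k.-tuple R => (dotv (colv v - m) (colv v - m))%:E).
  by apply/measurable_EFinP; exact: measurable_sqnorm_colv.
apply: (@le_trans _ _ (\int[gauss_law m S]_v (((t / 2)%:E +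
    (2 * t)^-1%:E * ((e v - 1) ^+ 2)%:E) +
    2^-1%:E * (dotv (colv v - m) (colv v - m))%:E))).
  apply: ge0_le_integral_nonmeas => v //.
  rewrite -!EFinM -!EFinD lee_fin /gauss_tilt -dotvNl expRD -/(e v) expRN.
  set h := dotv (colv v - m) (colv v - m).
  have h0 : (0 <= h / 2)%R by rewrite divr_ge0// dotv_ge0.
  have he : ((expR (h / 2))^-1 <= 1)%R by rewrite -expRN expR_le1 oppr_le0.
  have he' : (1 - h / 2 <= (expR (h / 2))^-1)%R.
    by rewrite -expRN; apply: le_trans (expR_ge1Dx _).
  have hp : (0 < (expR (h / 2))^-1)%R by rewrite invr_gt0 expR_gt0.
  set p := ((expR (h / 2))^-1)%R in he he' hp *.
  have -> : (e v * p - 1 = (e v - 1) * p - (1 - p))%R by ring.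
  apply: le_trans (ler_normB _ _) _; apply: lerD; last first.
    by rewrite ger0_norm; lra.
  apply: (@le_trans _ _ `|e v - 1|%R).
    by rewrite normrM (ger0_norm (ltW hp)) ler_piMr.
  (* AM-GM: [x <= t / 2 + x^2 / (2 t)] with [x = |e v - 1|] *)
  rewrite -[X in (_ <= _ + _ * X)%R]real_normK ?num_real//.
  set x := `|e v - 1|%R.
  have -> : (t / 2 + (2 * t)^-1 * x ^+ 2 = x + (x - t) ^+ 2 / (2 * t))%R.
    by field; rewrite gt_eqF.
  by rewrite lerDl divr_ge0 ?sqr_ge0// mulr_ge0// ltW.
have t20 : (0 <= (2 * t)^-1)%R by rewrite invr_ge0 mulr_ge0// ltW.
rewrite ge0_integralD//; last 4 first.
- move=> v _; rewrite -EFinM -EFinD lee_fin addr_ge0 ?divr_ge0// ?(ltW t0)//.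
  by rewrite mulr_ge0// sqr_ge0.
- by apply: emeasurable_funD => //; exact: emeasurable_funM.
- by move=> v _; rewrite mule_ge0// lee_fin dotv_ge0.
- exact: emeasurable_funM.
rewrite ge0_integralD//; last 3 first.
- by move=> v _; rewrite lee_fin divr_ge0// ltW.
- by move=> v _; rewrite -EFinM lee_fin mulr_ge0// sqr_ge0.
- exact: emeasurable_funM.
rewrite integral_cst// [X in (t / 2)%:E * X]gauss_law_setT// mule1.
rewrite ge0_integralZl_EFin//; last by move=> v _; rewrite lee_fin sqr_ge0.
rewrite ge0_integralZl_EFin//; last by move=> v _; rewrite lee_fin dotv_ge0.
rewrite !EFinD; apply: leeD; first apply: leeD => //.
  apply: (@le_trans _ _ ((2 * t)^-1%:E * (4 * w)%:E)).
    by apply: lee_wpmul2l; [rewrite lee_fin|exact: gauss_law_sqr_expR_sub1].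
  rewrite -EFinM lee_fin le_eqVlt; apply/orP; left; apply/eqP.
  by field; rewrite gt_eqF.
by rewrite mulrC EFinM; apply: lee_wpmul2l.
Qed.

End tilted_gaussian.

(** * Least squares and the posterior *)

Lemma dotv_mulr (R : realType) n k (M : 'M[R]_(n, k)) (u : 'cV[R]_n)
    (v : 'cV[R]_k) : dotv u (M *m v) = dotv (M^T *m u) v.
Proof. by rewrite /dotv trmx_mul trmxK mulmxA. Qed.

Lemma qform_scalar (R : realType) n (c : R) (v : 'cV[R]_n) :
  qform c%:M v = c * dotv v v.
Proof. by rewrite qformE mul_scalar_mx dotvZr. Qed.

Lemma posdef_scalar (R : realType) n (c : R) : 0 < c -> posdef (c%:M : 'M[R]_n).
Proof. by move=> c0; rewrite -scalemx1; exact/posdefZ/posdef1. Qed.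

Lemma dotvD_le (R : realType) n (u v : 'cV[R]_n) :
  dotv (u + v) (u + v) <= 2 * dotv u u + 2 * dotv v v.
Proof.
have := dotv_ge0 (u - v).
by rewrite !dotvDl !dotvDr !dotvNl !dotvNr (dotvC v u); lra.
Qed.

Lemma row_trE (R : realType) n k (M : 'M[R]_(k, n)) (i : 'I_k) :
  (row i M)^T = M^T *m (row i 1%:M)^T.
Proof. by rewrite -trmx_mul -row_mul mul1mx. Qed.

(** Infinite [x] is covered: a positive multiple stays infinite and [fine] sends it to 0. *)
Lemma fineZl (R : realType) (C : R) (x : \bar R) : 0 < C ->
  fine (C%:E * x)%E = C * fine x.
Proof.
case: x => [x| |] C0 //=; first by rewrite gt0_muley ?lte_fin//= mulr0.
by rewrite gt0_muleNy ?lte_fin//= mulr0.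
Qed.

Section least_squares.
Variables (R : realType) (n k : nat) (Phi : 'M[R]_(n, k)) (kap : R).
Hypothesis kap0 : 0 < kap.
Hypothesis kapP : forall v : 'cV[R]_k, kap * dotv v v <= qform (gram Phi) v.

Let B : 'M[R]_(k, n) := invmx (gram Phi) *m Phi^T.

Lemma qform_gram (v : 'cV[R]_k) : qform (gram Phi) v = dotv (Phi *m v) (Phi *m v).
Proof. by rewrite qformE /gram -mulmxA dotv_mulr trmxK. Qed.

Lemma posdef_gram : posdef (gram Phi).
Proof.
split; first by rewrite /gram trmx_mul trmxK.
move=> v v0; apply: lt_le_trans (kapP v).
by rewrite mulr_gt0// dotv_gt0.
Qed.

Let Gu : gram Phi \in unitmx := posdef_unitmx posdef_gram.

(** Let [x] be the inverse Gram matrix applied to [a]. Expanding [|a - kap x|^2 >= 0] and bounding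
    [kap |x|^2] by [<a, x>], which is [kapP] at [x], gives [kap <a, x> <= |a|^2]. *)
Lemma qform_invmx_gram_le (a : 'cV[R]_k) :
  qform (invmx (gram Phi)) a <= dotv a a / kap.
Proof.
rewrite ler_pdivlMr// qformE.
have := kapP (invmx (gram Phi) *m a); have := dotv_ge0 (a - kap *: (invmx (gram Phi) *m a)).
rewrite qformE mulKVmx// dotvBl !dotvBr !dotvZl !dotvZr.
rewrite (dotvC (invmx (gram Phi) *m a) a).
move: kap0; set q := dotv a (_ *m _); set p := dotv (_ *m _) _; set r := dotv a a.
nra.
Qed.

(** The normal equations. *)
Lemma tr_gram_lse (y : 'cV[R]_n) : Phi^T *m (Phi *m lse Phi y) = Phi^T *m y.
Proof. by rewrite /lse -!mulmxA mulmxA -/(gram Phi) mulKVmx. Qed.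

(** The residual is orthogonal to the range of [Phi]. This splits the likelihood exponent into a
    part free of [v] and a quadratic form centred at the least squares estimate. *)
Lemma residual_pythagoras (y : 'cV[R]_n) (v : 'cV[R]_k) :
  dotv (y - Phi *m v) (y - Phi *m v) =
  dotv (y - Phi *m lse Phi y) (y - Phi *m lse Phi y) +
  qform (gram Phi) (v - lse Phi y).
Proof.
set r := y - Phi *m lse Phi y; set h := v - lse Phi y.
have -> : y - Phi *m v = r - Phi *m h by rewrite /h mulmxBr opprB addrA subrK.
have rh : dotv r (Phi *m h) = 0.
  rewrite dotv_mulr /r mulmxBr tr_gram_lse subrr.
  by rewrite /dotv trmx0 mul0mx mxE.
clearbody r h.
by rewrite qform_gram dotvBl !dotvBr (dotvC _ r) rh; ring.
Qed.

(** Pythagoras at [v = 0] bounds the fitted vector by [y]; [kapP] passes from the fitted vector to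
    its coefficients. *)
Lemma lse_norm_le (y : 'cV[R]_n) : dotv (lse Phi y) (lse Phi y) <= dotv y y / kap.
Proof.
rewrite ler_pdivlMr// mulrC; apply: le_trans (kapP _) _.
have := residual_pythagoras y 0; rewrite mulmx0 subr0 sub0r => ->.
have -> : qform (gram Phi) (- lse Phi y) = qform (gram Phi) (lse Phi y).
  by rewrite !qformE mulmxN dotvNl dotvNr opprK.
by rewrite lerDr dotv_ge0.
Qed.

Lemma lse_sub (y z : 'cV[R]_n) : lse Phi y - lse Phi z = B *m (y - z).
Proof. by rewrite mulmxBr. Qed.

Lemma row1_norm (i : 'I_k) :
  dotv (row i 1%:M)^T (row i 1%:M)^T = 1 :> R.
Proof. by rewrite /dotv trmxK -row_mul mul1mx !mxE eqxx. Qed.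

Variable sigma : R.
Hypothesis sigma0 : 0 < sigma.
Let S := sigma ^+ 2 *: invmx (gram Phi).

Lemma posdef_lse_cov : posdef S.
Proof. by apply: posdefZ; [rewrite exprn_gt0|exact/posdef_invmx/posdef_gram]. Qed.

Lemma qform_lse_cov_le (a : 'cV[R]_k) :
  qform S a <= sigma ^+ 2 / kap * dotv a a.
Proof.
rewrite qformZl -mulrA ler_pM2l ?exprn_gt0// mulrC.
exact: qform_invmx_gram_le.
Qed.

Lemma qform_lse_cov_row_le (i : 'I_k) :
  qform S (row i 1%:M)^T <= sigma ^+ 2 / kap.
Proof. by apply: le_trans (qform_lse_cov_le _) _; rewrite row1_norm mulr1. Qed.

(** Under the noise, the least squares estimate has covariance [sigma^2 B B^T], which equals [S], so
    the bound on the diagonal of [S] applies. *)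
Lemma qform_noise_row_le (i : 'I_k) :
  qform (sigma ^+ 2)%:M (row i B)^T <= sigma ^+ 2 / kap.
Proof.
apply: le_trans (qform_lse_cov_row_le i).
rewrite qform_scalar qformZl ler_pM2l ?exprn_gt0//.
have [iGs _] := posdef_invmx posdef_gram.
rewrite row_trE -dotv_mulr qformE; set e := (row i _)^T.
have -> : B *m (B^T *m e) = invmx (gram Phi) *m e; last exact: lexx.
rewrite /B trmx_mul trmxK iGs !mulmxA.
by rewrite -(mulmxA (invmx _) Phi^T Phi) -/(gram Phi) mulVmx// mul1mx.
Qed.

Lemma posterior_density (y : n.-tuple R) : exists2 C : R, 0 < C &
  forall v : k.-tuple R,
    gauss_pdf (Phi *m colv v) (sigma ^+ 2)%:M (colv y) *
      gauss_pdf 0 1%:M (colv v) =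
    C * (gauss_tilt (lse Phi (colv y)) v *
      gauss_pdf (lse Phi (colv y)) S (colv v)).
Proof.
have nc_gt0 p (M : 'M[R]_p) : posdef M ->
    0 < (Num.sqrt ((2 * pi) ^+ p * \det M))^-1.
  move=> Mpos; rewrite invr_gt0 sqrtr_gt0 mulr_gt0 ?det_posdef_gt0//.
  by rewrite exprn_gt0// mulr_gt0// pi_gt0.
have s20 : 0 < sigma ^+ 2 by rewrite exprn_gt0.
have c1 := nc_gt0 _ _ (@posdef_scalar R n _ s20).
have c2 := nc_gt0 _ _ (@posdef1 R k).
have c3 := nc_gt0 _ _ posdef_lse_cov.
set th := lse Phi (colv y).
pose r := colv y - Phi *m th.
rewrite /gauss_pdf.
set C1 := (Num.sqrt _)^-1 in c1 *; set C2 := (Num.sqrt _)^-1 in c2 *.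
set C3 := (Num.sqrt _)^-1 in c3 *.
(* All that depends on [y] alone: the normalizing constants, the residual part of the likelihood and
   the prior exponent at [th]. *)
exists (C1 * C2 / C3 * expR (- dotv r r / (2 * sigma ^+ 2) - dotv th th / 2)).
  by rewrite mulr_gt0 ?expR_gt0// divr_gt0// mulr_gt0.
move=> v; rewrite -!/(qform _ _) subr0 invmx1 [qform 1%:M _]qformE mul1mx.
rewrite invmx_scalar qform_scalar residual_pythagoras -/th -/r.
rewrite invmxZ; last first.
  by rewrite unitmxZ ?unitfE ?gt_eqF// unitmx_inv.
rewrite invmxK qformZl /gauss_tilt.
set h := colv v - th.
have vE : colv v = th + h by rewrite addrC subrK.
clearbody h r; rewrite vE !dotvDl !dotvDr (dotvC h th).
rewrite [LHS]mulrACA -expRD.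
rewrite [RHS](_ : _ = C1 * C2 * (expR (- dotv r r / (2 * sigma ^+ 2) - dotv th th / 2) *
  (expR (- dotv th h - dotv h h / 2) * expR (- (sigma ^- 2 * qform (gram Phi) h) / 2)))).
  rewrite -!expRD; congr (_ * expR _).
  by field; rewrite gt_eqF.
by field; rewrite gt_eqF.
Qed.

Let lik (y : n.-tuple R) (v : k.-tuple R) : R :=
  gauss_pdf (Phi *m colv v) (sigma ^+ 2)%:M (colv y).

Let measurable_lik (y : n.-tuple R) : measurable_fun setT (lik y).
Proof.
rewrite /lik /gauss_pdf; apply: measurable_funM; first exact: measurable_cst.
apply: measurableT_comp; first exact: measurable_expR.
apply: measurable_funM; last exact: measurable_cst.
rewrite invmx_scalar.
(* Pythagoras rewrites the exponent as a quadratic form in [colv v] minus a fixed vector, whose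
   measurability is known. *)
rewrite [X in measurable_fun _ X](_ : _ = fun v : k.-tuple R =>
  - (sigma ^- 2 * (dotv (colv y - Phi *m lse Phi (colv y))
    (colv y - Phi *m lse Phi (colv y)) +
    qform (gram Phi) (colv v - lse Phi (colv y))))).
  apply: measurableT_comp; first exact: oppr_measurable.
  apply: measurable_funM; first exact: measurable_cst.
  apply: measurable_funD; first exact: measurable_cst.
  exact: measurable_qform_colv.
apply/funext => v; congr (- _).
by rewrite -residual_pythagoras -qform_scalar.
Qed.

Let integral_lik (y : n.-tuple R) : exists2 C : R, 0 < C &
  forall A, measurable A -> (\int[gauss_law 0 1%:M]_(v in A) (lik y v)%:E =
    C%:E * \int[gauss_law (lse Phi (colv y)) S]_(v in A)
      (gauss_tilt (lse Phi (colv y)) v)%:E)%E.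
Proof.
have [C C0 CE] := posterior_density y.
exists C => // A mA; set th := lse Phi (colv y) in CE *.
have mtilt : measurable_fun A (fun v => (gauss_tilt th v)%:E).
  by apply: measurable_funTS; apply/measurable_EFinP; exact: measurable_gauss_tilt.
have tilt0 (v : k.-tuple R) : (0 <= (gauss_tilt th v)%:E)%E.
  by rewrite lee_fin expR_ge0.
have mlik : measurable_fun A (fun v => (lik y v)%:E).
  by apply: measurable_funTS; apply/measurable_EFinP; exact: measurable_lik.
have lik0 (v : k.-tuple R) : (0 <= (lik y v)%:E)%E.
  by rewrite lee_fin; exact: gauss_pdf_ge0.
etransitivity; first exact: (ge0_integral_gauss_law 0 1%:M mA mlik lik0).
transitivity (C%:E * \int[lebesgue_tuple R k]_(v in A)
    ((gauss_tilt th v)%:E * (gauss_pdf th S (colv v))%:E))%E; last first.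
  congr (_ * _)%E; apply/esym.
  exact: (ge0_integral_gauss_law th S mA mtilt tilt0).
etransitivity; last first.
  apply: ge0_integralZl_EFin; last exact: ltW.
  - exact: mA.
  - by move=> v _; apply: mule_ge0 => //; rewrite lee_fin; exact: gauss_pdf_ge0.
  - apply: emeasurable_funM; first exact: mtilt.
    by apply: measurable_funTS; apply/measurable_EFinP; exact: measurable_gauss_pdf.
apply: eq_integral => v _; rewrite -!EFinM; congr (_%:E); exact: CE.
Qed.

(** The factor [C] of [integral_lik] is the same for [A] and for the whole space, so it cancels in
    Bayes' formula. *)
Lemma posterior_tilt (y : n.-tuple R) (A : set (k.-tuple R)) : measurable A ->
  posterior Phi sigma (gauss_law 0 1%:M) y A =
  ((\int[gauss_law (lse Phi (colv y)) S]_(v in A) gauss_tilt (lse Phi (colv y)) v) /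
   (\int[gauss_law (lse Phi (colv y)) S]_v gauss_tilt (lse Phi (colv y)) v))%:E.
Proof.
move=> mA; have [C C0 CE] := integral_lik y.
have intE D : measurable D ->
    \int[gauss_law 0 1%:M]_(v in D) lik y v =
    C * \int[gauss_law (lse Phi (colv y)) S]_(v in D)
      gauss_tilt (lse Phi (colv y)) v.
  move=> mD; rewrite /Rintegral.
  etransitivity; first exact: (congr1 fine (CE D mD)).
  exact: fineZl.
etransitivity.
  have intAE := congr2 (fun a b : R => (a / b)%:E)
    (intE A mA) (intE setT measurableT).
  exact: intAE.
by congr (_%:E); rewrite -mulf_div divff ?mul1r// gt_eqF.
Qed.

End least_squares.

(** * Bounds on the posterior at fixed [n] *)

Section posterior_bounds.
Variables (R : realType) (n k : nat) (Phi : 'M[R]_(n, k)) (kap sigma : R).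
Hypothesis kap0 : 0 < kap.
Hypothesis kapP : forall v : 'cV[R]_k, kap * dotv v v <= qform (gram Phi) v.
Hypothesis sigma0 : 0 < sigma.

Let S := sigma ^+ 2 *: invmx (gram Phi).
(** Bounds the coordinate variances both of [Q y] and of the least squares estimate. *)
Let s := sigma ^+ 2 / kap.
Let th (y : n.-tuple R) := lse Phi (colv y).
Let Q (y : n.-tuple R) := gauss_law (th y) S.
Let post (y : n.-tuple R) := posterior Phi sigma (gauss_law 0 1%:M) y.

Let s_gt0 : 0 < s. Proof. by rewrite divr_gt0// exprn_gt0. Qed.

Let Spos : posdef S. Proof. exact: (posdef_lse_cov kap0 kapP sigma0). Qed.

Let Q_le1 (y : n.-tuple R) A : measurable A -> (Q y A <= 1)%E.
Proof. by move=> mA; rewrite -(gauss_law_setT (th y) Spos) le_measure// inE. Qed.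

Let Q_fin (y : n.-tuple R) A : measurable A -> Q y A \is a fin_num.
Proof. by move=> mA; rewrite ge0_fin_numE// (le_lt_trans (Q_le1 y mA))// ltry. Qed.

Let Q_moment (y : n.-tuple R) :
  (\int[Q y]_v (dotv (colv v - th y) (colv v - th y))%:E <= (8 * s *+ k)%:E)%E.
Proof.
have := @gauss_law_norm_moment R k (th y) S Spos k 1%:M s s_gt0
  (qform_lse_cov_row_le kap0 kapP sigma0).
by apply: le_trans; under [leRHS]eq_integral do rewrite mul1mx.
Qed.

(** Completing the square bounds the tilt by [expR (|th|^2 / 2)]. This crude bound only ensures
    finite integrals, so that the posterior mass lies between 0 and 1 for every [y]. *)
Let tilt_bounded (y : n.-tuple R) :
  (\int[Q y]_v (`|gauss_tilt (th y) v - 1|)%:E <=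
    (1 + expR (dotv (th y) (th y) / 2))%:E)%E.
Proof.
set c := 1 + _.
apply: (@le_trans _ _ (\int[Q y]_v (cst c%:E v)))%E; last first.
  by rewrite integral_cst// [X in (_ * X)%E](gauss_law_setT (th y) Spos) mule1.
apply: ge0_le_integral_nonmeas => v; rewrite lee_fin//=.
apply: le_trans (ler_normB _ _) _; rewrite normr1 addrC lerD2l.
rewrite ger0_norm ?expR_ge0// ler_expR.
have := dotv_ge0 (th y + (colv v - th y)); set h := colv v - th y; clearbody h.
rewrite dotvDl !dotvDr (dotvC h); lra.
Qed.

(** Twice the bound of [gauss_tilt_near1], with [w = s |th|^2] and [b = 8 s k]. It is affine in
    [|th|^2], so its expectation over the data is within reach. *)
Lemma posterior_near (y : n.-tuple R) (A : set (k.-tuple R)) (t : R) :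
  0 < t <= 1 -> measurable A ->
  (`|post y A - Q y A| <=
    (t + 4 * (s * dotv (th y) (th y)) / t + 8 * s *+ k)%:E)%E.
Proof.
move=> /andP[t0 t1] mA.
rewrite /post (posterior_tilt kap0 kapP sigma0 y mA) -/S -/(th y) -/(Q y).
rewrite -(fineK (Q_fin y mA)) -EFinB lee_fin.
set w := s * _.
have sk0 : 0 <= 8 * s *+ k by rewrite mulrn_wge0// mulr_ge0// ltW.
(* for [w > 1/4] the bound exceeds [1] *)
have [w4|w4] := leP w 4^-1.
  have mw : qform S (th y) <= w <= 4^-1.
    by rewrite w4 andbT; exact: qform_lse_cov_le.
  have := normalized_weight_near (gauss_law_setT (th y) Spos)
    (measurable_gauss_tilt (th y)) (fun=> expR_ge0 _)
    (gauss_tilt_near1 Spos t0 mw (Q_moment y)) mA.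
  move=> /le_trans; apply; rewrite le_eqVlt; apply/orP; left; apply/eqP.
  by field; rewrite gt_eqF.
have /andP[p0 p1] := normalized_weight_le1 (gauss_law_setT (th y) Spos)
    (measurable_gauss_tilt (th y)) (fun=> expR_ge0 _) (tilt_bounded y) mA.
have q0 : 0 <= fine (Q y A) by rewrite fine_ge0.
have q1 : fine (Q y A) <= 1.
  by rewrite -lee_fin fineK ?Q_le1// Q_fin.
have wt : 1 <= 4 * w / t by rewrite ler_pdivlMr//; lra.
set p := (_ / _) in p0 p1 *.
by rewrite ler_norml; apply/andP; split; lra.
Qed.

Lemma tv_posterior_le (y : n.-tuple R) (t : R) : 0 < t <= 1 ->
  (tv_dist (post y) (Q y) <=
    (t + 4 * (s * dotv (th y) (th y)) / t + 8 * s *+ k)%:E)%E.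
Proof.
by move=> t01; apply: ge_ereal_sup => _ [A mA <-]; exact: posterior_near.
Qed.

Variable F0 : 'cV[R]_n.
Let P := gauss_law F0 (sigma ^+ 2)%:M.
Let th0 := lse Phi F0.
Let err (y : n.-tuple R) := dotv (th y - th0) (th y - th0).

Let Ppos : posdef ((sigma ^+ 2)%:M : 'M[R]_n).
Proof. by apply: posdef_scalar; rewrite exprn_gt0. Qed.

Let err_moment : (\int[P]_y (err y)%:E <= (8 * s *+ k)%:E)%E.
Proof.
have := @gauss_law_norm_moment R n F0 _ Ppos k (invmx (gram Phi) *m Phi^T) s
  s_gt0 (qform_noise_row_le kap0 kapP sigma0).
apply: le_trans; under [leRHS]eq_integral do rewrite -lse_sub.
exact: lexx.
Qed.

Let measurable_err : measurable_fun setT (fun y => (err y)%:E).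
Proof.
rewrite [X in measurable_fun _ X](_ : _ = fun y : n.-tuple R =>
  (qform ((invmx (gram Phi) *m Phi^T)^T *m (invmx (gram Phi) *m Phi^T))
    (colv y - F0))%:E).
  by apply/measurable_EFinP; exact: measurable_qform_colv.
by apply/funext => y; rewrite /err lse_sub qformE -[in RHS]mulmxA [in RHS]dotv_mulr trmxK.
Qed.

(** Used for total variation and for posterior mass as functions of the data: [f] is only compared
    with the affine bound, and the integral of that bound is controlled by [err_moment]. *)
Lemma expectation_affine_le (f : n.-tuple R -> \bar R) (c0 c1 : R) :
  0 <= c0 -> 0 <= c1 -> (forall y, 0 <= f y)%E ->
  (forall y, f y <= (c0 + c1 * err y)%:E)%E ->
  (\int[P]_y f y <= (c0 + c1 * (8 * s *+ k))%:E)%E.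
Proof.
move=> c00 c10 f0 fle.
apply: (@le_trans _ _ (\int[P]_y (c0%:E + c1%:E * (err y)%:E)))%E.
  by apply: ge0_le_integral_nonmeas => // y; rewrite -EFinM -EFinD.
rewrite ge0_integralD//; last 2 first.
- by move=> y _; rewrite mule_ge0// lee_fin dotv_ge0.
- exact: emeasurable_funM.
rewrite ge0_integralZl_EFin//; last by move=> y _; rewrite lee_fin dotv_ge0.
rewrite integral_cst// [X in (c0%:E * X)%E](gauss_law_setT F0 Ppos) mule1.
by rewrite EFinD EFinM; apply: leeD => //; apply: lee_wpmul2l.
Qed.

Let th_norm_le (y : n.-tuple R) :
  dotv (th y) (th y) <= 2 * (dotv F0 F0 / kap) + 2 * err y.
Proof.
have := dotvD_le th0 (th y - th0); rewrite addrC subrK => /le_trans; apply.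
by rewrite lerD2r ler_pM2l//; exact: lse_norm_le.
Qed.

(** [t] is the free parameter of the AM-GM step in [gauss_tilt_near1]; the
    choice [t = k / sqrt n] makes the bound [O(t)]. *)
Definition tv_bound (t : R) : R :=
  t + 4 * s / t * (2 * (dotv F0 F0 / kap) + 2 * (8 * s *+ k)) + 8 * s *+ k.

Let affine_bound (y : n.-tuple R) (t : R) : 0 < t ->
  t + 4 * (s * dotv (th y) (th y)) / t + 8 * s *+ k <=
  t + 4 * s / t * (2 * (dotv F0 F0 / kap)) + 8 * s *+ k + 4 * s / t * 2 * err y.
Proof.
move=> t0; have := th_norm_le y => h.
have c0 : 0 < 4 * s / t by rewrite divr_gt0// mulr_gt0.
have -> : 4 * (s * dotv (th y) (th y)) / t = 4 * s / t * dotv (th y) (th y).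
  by field; rewrite gt_eqF.
have : 4 * s / t * dotv (th y) (th y) <=
    4 * s / t * (2 * (dotv F0 F0 / kap) + 2 * err y) by rewrite ler_pM2l.
by rewrite mulrDr mulrA; lra.
Qed.

Let sk_ge0 : 0 <= 8 * s *+ k.
Proof. by rewrite mulrn_wge0// mulr_ge0// ltW. Qed.

Let c1_ge0 (t : R) : 0 < t -> 0 <= 4 * s / t.
Proof.
move=> t0; apply: divr_ge0; last exact: ltW.
by apply: mulr_ge0; last exact: ltW.
Qed.

Let c0_ge0 (t : R) : 0 < t ->
  0 <= t + 4 * s / t * (2 * (dotv F0 F0 / kap)) + 8 * s *+ k.
Proof.
move=> t0; rewrite !addr_ge0//; first exact: ltW.
apply: mulr_ge0; first exact: c1_ge0.
by rewrite mulr_ge0// divr_ge0 ?dotv_ge0 ?(ltW kap0).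
Qed.

Lemma expected_tv_le (t : R) : 0 < t <= 1 ->
  (\int[P]_y tv_dist (post y) (Q y) <= (tv_bound t)%:E)%E.
Proof.
move=> t01; have /andP[t0 t1] := t01.
have := @expectation_affine_le (fun y => tv_dist (post y) (Q y))
  (t + 4 * s / t * (2 * (dotv F0 F0 / kap)) + 8 * s *+ k) (4 * s / t * 2) (c0_ge0 t0).
have -> : (t + 4 * s / t * (2 * (dotv F0 F0 / kap)) + 8 * s *+ k +
    4 * s / t * 2 * (8 * s *+ k)) = tv_bound t by rewrite /tv_bound; ring.
apply.
- by rewrite mulr_ge0// c1_ge0.
- move=> y; apply: le_trans (abse_ge0 (post y set0 - Q y set0)%E) _.
  by apply: ereal_sup_ubound; exists set0.
- move=> y; apply: le_trans (tv_posterior_le y t01) _.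
  by rewrite lee_fin; exact: affine_bound.
Qed.

Definition far_set (rho : R) : set (k.-tuple R) :=
  [set v | rho <= enorm (colv v - th0)].

Lemma measurable_far_set (rho : R) : measurable (far_set rho).
Proof.
have -> : far_set rho = (fun v : k.-tuple R => enorm (colv v - th0)) @^-1` `[rho, +oo[%classic.
  by apply/seteqP; split => v; rewrite /far_set/= in_itv/= andbT.
rewrite -[X in measurable X]setTI.
have menorm : measurable_fun setT (fun v : k.-tuple R => enorm (colv v - th0)).
  apply: measurableT_comp; first by apply: continuous_measurable_fun; exact: sqrt_continuous.
  rewrite [X in measurable_fun _ X](_ : _ = fun v : k.-tuple R =>
    dotv (colv v - th0) (colv v - th0)); first exact: measurable_sqnorm_colv.
  by apply/funext => v; rewrite dotvE; apply: eq_bigr => i _; rewrite expr2.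
by apply: menorm.
Qed.

(** Markov's inequality: on the far set, [rho^2 <= |v - th0|^2 <= 2 |v - th|^2 + 2 err y]. *)
Lemma gauss_far_le (y : n.-tuple R) (rho : R) : 0 < rho ->
  (Q y (far_set rho) <= (rho ^- 2 * (2 * (8 * s *+ k) + 2 * err y))%:E)%E.
Proof.
move=> rho0.
have r2 : 0 < rho ^- 2 by rewrite invr_gt0 exprn_gt0.
have mh : measurable_fun setT
    (fun v : k.-tuple R => (dotv (colv v - th y) (colv v - th y))%:E).
  by apply/measurable_EFinP; exact: measurable_sqnorm_colv.
have mfar := measurable_far_set rho.
have <- : (\int[Q y]_v (\1_(far_set rho) v)%:E = Q y (far_set rho))%E.
  by rewrite integral_indic// setIT.
apply: (@le_trans _ _ (\int[Q y]_v ((rho ^- 2)%:E * (2%:E *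
   (dotv (colv v - th y) (colv v - th y))%:E + (2 * err y)%:E)))%E).
  apply: ge0_le_integral_nonmeas => v; first by rewrite lee_fin.
  rewrite -EFinM lee_fin.
  have rhs0 : 0 <= rho ^- 2 * (2 * dotv (colv v - th y) (colv v - th y) + 2 * err y).
    by rewrite mulr_ge0 ?(ltW r2)// addr_ge0// mulr_ge0// dotv_ge0.
  rewrite indicE; case: (boolP (v \in far_set rho)) => //= /set_mem vfar.
  rewrite -ler_pdivrMl// mulr1 invrK.
  have := dotvD_le (colv v - th y) (th y - th0); rewrite addrA subrK.
  apply: le_trans; rewrite -sqr_enorm ler_sqr ?nnegrE ?(ltW rho0)// sqrtr_ge0//.
rewrite ge0_integralZl_EFin//; last 3 first.
- move=> v _; rewrite -EFinM -EFinD lee_fin addr_ge0// mulr_ge0// dotv_ge0//.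
- by apply: emeasurable_funD => //; exact: emeasurable_funM.
- exact: ltW.
rewrite [leRHS]EFinM; apply: lee_wpmul2l; first by rewrite lee_fin ltW.
rewrite ge0_integralD//; last 3 first.
- by move=> v _; rewrite mule_ge0// lee_fin dotv_ge0.
- exact: emeasurable_funM.
- by move=> v _; rewrite lee_fin mulr_ge0// dotv_ge0.
rewrite ge0_integralZl_EFin//; last by move=> v _; rewrite lee_fin dotv_ge0.
rewrite integral_cst// [X in (_ + _ * X)%E](gauss_law_setT (th y) Spos) mule1.
rewrite [leRHS]EFinD; apply: leeD => //; rewrite [leRHS]EFinM.
by apply: lee_wpmul2l => //; exact: Q_moment.
Qed.

(** The posterior mass is at most the Gaussian mass plus the error of [posterior_near]; both bounds
    are affine in [err y]. *)
Lemma expected_posterior_far_le (rho t : R) : 0 < rho -> 0 < t <= 1 ->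
  (\int[P]_y post y (far_set rho) <=
    (tv_bound t + rho ^- 2 * (4 * (8 * s *+ k)))%:E)%E.
Proof.
move=> rho0 t01; have /andP[t0 t1] := t01.
have r2 : 0 <= rho ^- 2 by rewrite invr_ge0 exprn_ge0// ltW.
have mfar := measurable_far_set rho.
set c0 := t + 4 * s / t * (2 * (dotv F0 F0 / kap)) + 8 * s *+ k.
have := @expectation_affine_le (fun y => post y (far_set rho))
  (c0 + rho ^- 2 * (2 * (8 * s *+ k))) (4 * s / t * 2 + rho ^- 2 * 2).
have -> : c0 + rho ^- 2 * (2 * (8 * s *+ k)) +
    (4 * s / t * 2 + rho ^- 2 * 2) * (8 * s *+ k) =
    tv_bound t + rho ^- 2 * (4 * (8 * s *+ k)).
  rewrite /tv_bound /c0; set X := 8 * s *+ k.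
  set a := 4 * s / t; set r := rho ^- 2; set F := 2 * (_ / kap).
  by clearbody X a r F; ring.
apply.
- by rewrite addr_ge0 ?c0_ge0// mulr_ge0// mulr_ge0.
- apply: addr_ge0; last exact: mulr_ge0.
  by rewrite mulr_ge0// c1_ge0.
- move=> y; rewrite /post (posterior_tilt kap0 kapP sigma0 y mfar) lee_fin.
  by rewrite divr_ge0// Rintegral_ge0// => v _; exact: expR_ge0.
- move=> y.
  have := posterior_near y t01 mfar; have := gauss_far_le y rho0.
  rewrite -(fineK (Q_fin y mfar)).
  rewrite /post (posterior_tilt kap0 kapP sigma0 y mfar).
  rewrite -EFinB !lee_fin ler_norml; set p := Rintegral _ _ _ / _ => q1 /andP[_ q2].
  have := affine_bound y t0; rewrite -/c0; lra.
Qed.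

End posterior_bounds.

(** * Asymptotics *)

Lemma cvge0_le (R : realType) (u : nat -> \bar R) : (forall n, 0 <= u n)%E ->
  (forall e : R, 0 < e -> \forall n \near \oo, (u n <= e%:E)%E) ->
  u @ \oo --> 0%E.
Proof.
move=> u0 ue; apply/fine_cvgP; split.
  near=> n; rewrite ge0_fin_numE// (@le_lt_trans _ _ 1%:E) ?ltry//.
  by near: n; exact: ue.
apply/cvgr0Pnorm_le => e e0; near=> n.
have une : (u n <= e%:E)%E by near: n; exact: ue.
rewrite ger0_norm ?fine_ge0//= -lee_fin fineK// ge0_fin_numE//.
by rewrite (le_lt_trans une) ?ltry.
Unshelve. all: by end_near. Qed.

(** Cubing gives [k^3 <= d^3 n / ln n], where [ln n >= 1] once [n >= expR 1]; and [k^2 <= k^3] for a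
    natural number. *)
Lemma littleo_cbrt_sqr_le (R : realType) (k : nat -> nat) :
  (fun n => (k n)%:R : R^o) =o_\oo
    (fun n => (n%:R / ln n%:R) `^ (3^-1) : R^o) ->
  forall e : R, 0 < e -> \forall n \near \oo, (k n)%:R ^+ 2 <= e * n%:R.
Proof.
(* With this choice [d^3 <= d <= e]. *)
move=> /eqoP ko e e0; pose d := Num.min 1 e.
have d0 : 0 < d by rewrite lt_min ltr01.
near=> n.
have kn : `|(k n)%:R : R| <= d * `|(n%:R / ln n%:R) `^ 3^-1|.
  by near: n; exact: (ko _ d0).
have n_e : expR 1 <= n%:R :> R by near: n; exact: nbhs_infty_ger.
have n0 : 0 < n%:R :> R by apply: lt_le_trans n_e; exact: expR_gt0.
have ln1 : 1 <= ln n%:R :> R.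
  by rewrite -[leLHS]expRK ler_ln ?posrE// expR_gt0.
have ln0 : 0 < ln n%:R :> R by exact: lt_le_trans ln1.
set z := n%:R / ln n%:R in kn.
have z0 : 0 <= z by rewrite divr_ge0// ltW.
have zn : z <= n%:R by rewrite ler_pdivrMr// ler_peMr// ltW.
have z3 : (z `^ 3^-1) ^+ 3 = z.
  by rewrite -powR_mulrn ?powR_ge0// -powRrM mulVf ?pnatr_eq0// powRr1.
rewrite normr_nat ger0_norm ?powR_ge0// in kn.
have k3 : (k n)%:R ^+ 3 <= e * n%:R :> R.
  apply: (@le_trans _ _ ((d * z `^ 3^-1) ^+ 3)).
    by rewrite lerXn2r ?nnegrE ?ler0n// mulr_ge0 ?powR_ge0// ltW.
  rewrite exprMn z3; apply: ler_pM => //; first by rewrite exprn_ge0// ltW.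
  have d1 : d <= 1 by rewrite /d ge_min lexx.
  have de : d <= e by rewrite /d ge_min lexx orbT.
  by apply: le_trans de; rewrite exprS ler_piMr ?exprn_ile1 ?(ltW d0).
apply: le_trans k3; rewrite -!natrX ler_nat.
by case: (k n) => // p; exact: leq_pexp2l.
Unshelve. all: by end_near. Qed.

(** For [kap = C1 n / k] and [t^2 = k^2 / n]: [s k = sigma^2 t^2 / C1], [s / t = sigma^2 t / (C1 k)]
    and [|F0|^2 / kap <= M^2 k / C1]. Then [t^2 <= k] (from [k <= n]) and [t^2 <= t] leave a
    multiple of [t]. *)
Lemma tv_bound_le (R : realType) (n k : nat) (C1 sigma M t : R) (F0 : 'cV[R]_n) :
  0 < C1 -> (0 < k)%N -> (k <= n)%N -> dotv F0 F0 <= n%:R * M ^+ 2 ->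
  t ^+ 2 = k%:R ^+ 2 / n%:R -> 0 < t <= 1 ->
  tv_bound k (C1 * (n%:R / k%:R)) sigma F0 t <=
  (1 + 8 * sigma ^+ 2 / C1 + 8 * sigma ^+ 2 * (M ^+ 2 + 8 * sigma ^+ 2) / C1 ^+ 2) * t.
Proof.
move=> C10 k0 kn F0M t2 /andP[t0 t1].
have K0 : 0 < k%:R :> R by rewrite ltr0n.
have N0 : 0 < n%:R :> R by rewrite ltr0n (leq_trans k0).
have KN : k%:R <= n%:R :> R by rewrite ler_nat.
rewrite /tv_bound -[8 * _ *+ k]mulr_natr.
set K : R := k%:R in t2 K0 KN *; set N : R := n%:R in F0M t2 N0 KN *.
set F := dotv F0 F0 in F0M *; clearbody K N F.
have -> : 8 * (sigma ^+ 2 / (C1 * (N / K))) * K = 8 * sigma ^+ 2 / C1 * t ^+ 2.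
  by rewrite t2; field; rewrite !gt_eqF.
have sN : 4 * (sigma ^+ 2 / (C1 * (N / K))) / t = 4 * sigma ^+ 2 / C1 * t / K.
  have -> : 4 * sigma ^+ 2 / C1 * t / K = 4 * sigma ^+ 2 / C1 * t ^+ 2 / K / t.
    by field; rewrite !gt_eqF.
  by rewrite t2; field; rewrite !gt_eqF.
rewrite sN.
set a := sigma ^+ 2 in sN *.
have a0 : 0 <= a by rewrite sqr_ge0.
have FK : F / (C1 * (N / K)) <= M ^+ 2 * K / C1.
  rewrite ler_pdivrMr; last by rewrite mulr_gt0// divr_gt0.
  apply: le_trans F0M _; rewrite le_eqVlt; apply/orP; left; apply/eqP.
  by field; rewrite !gt_eqF.
have tK : t ^+ 2 <= K.
  by rewrite t2 ler_pdivrMr// expr2 ler_pM2l.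
have c0 : 0 <= 4 * a / C1 * t / K.
  apply: divr_ge0; last exact: ltW.
  apply: mulr_ge0; last exact: ltW.
  by apply: divr_ge0; [exact: mulr_ge0|exact: ltW].
have c8 : 0 <= 8 * a / C1 by apply: divr_ge0; [exact: mulr_ge0|exact: ltW].
have h1 : 4 * a / C1 * t / K * (2 * (F / (C1 * (N / K))) + 2 * (8 * a / C1 * t ^+ 2))
   <= 4 * a / C1 * t / K * (2 * (M ^+ 2 * K / C1) + 2 * (8 * a / C1 * K)).
  apply: ler_wpM2l => //; apply: lerD; first by rewrite ler_pM2l.
  by rewrite ler_pM2l//; apply: ler_wpM2l.
have h2 : 8 * a / C1 * t ^+ 2 <= 8 * a / C1 * t.
  apply: ler_wpM2l => //.
  by rewrite expr2 ler_piMr// ltW.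
have e1 : 4 * a / C1 * t / K * (2 * (M ^+ 2 * K / C1) + 2 * (8 * a / C1 * K)) =
    8 * a * (M ^+ 2 + 8 * a) / C1 ^+ 2 * t.
  by field; rewrite !gt_eqF.
rewrite e1 in h1.
rewrite [leRHS]mulrDl (mulrDl 1 _ t) mul1r.
rewrite addrAC; apply: lerD; last exact: h1.
exact: lerD.
Qed.

Theorem proposition7 (R : realType) (alpha sigma : R) (f : R -> R) (q : nat)
    (k : nat -> nat) (x : forall n : nat, 'I_n -> R)
    (Phi := fun n => bspline_mx q (k n) (x n))
    (F0 := fun n => \col_(i < n) f (x n i))
    (alpha_gt0 : 0 < alpha)
    (f_holder : holder01 alpha f)
    (sigma_gt0 : 0 < sigma)
    (x01 : forall n i, x n i \in `[0, 1])
    (alpha_le_q : alpha <= q%:R)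
    (k_rank : \forall n \near \oo,
       [/\ (1 <= k n + 1 - q)%N, \rank (Phi n) = k n & (k n <= n)%N])
    (f_bounded : exists M : R, forall u : R, u \in `[0, 1] -> `|f u| <= M)
    (k_littleo : (fun n => (k n)%:R : R^o) =o_\oo
       (fun n => (n%:R / ln n%:R) `^ (3^-1) : R^o))
    (gram_bounds : exists C1 C2 : R, [/\ 0 < C1, 0 < C2 &
       \forall n \near \oo, forall theta : 'cV[R]_(k n),
         C1 * (n%:R / (k n)%:R) * enorm theta ^+ 2
           <= (theta^T *m gram (Phi n) *m theta) 0 0
           <= C2 * (n%:R / (k n)%:R) * enorm theta ^+ 2]) :
  let E n (Z : n.-tuple R -> \bar R) :=
    (\int[gauss_law (F0 n) (sigma ^+ 2)%:M]_y Z y)%E in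
  let W n := posterior (Phi n) sigma (gauss_law 0 1%:M) in
  ((fun n => E n (fun y =>
      tv_dist (W n y)
        (gauss_law (lse (Phi n) (colv y)) (sigma ^+ 2 *: invmx (gram (Phi n))))))
     @ \oo --> 0%E) /\
  (forall lambda : nat -> R, lambda @ \oo --> +oo ->
    (fun n => E n (fun y =>
      W n y [set theta |
        lambda n * ((k n)%:R / Num.sqrt n%:R)
          <= enorm (colv theta - lse (Phi n) (F0 n))]))
      @ \oo --> 0%E).
Proof.
move=> E W.
have [C1 [C2 [C10 C20 gramP]]] := gram_bounds.
have [M fM] := f_bounded.
pose D := 1 + 8 * sigma ^+ 2 / C1 +
  8 * sigma ^+ 2 * (M ^+ 2 + 8 * sigma ^+ 2) / C1 ^+ 2.
pose t n : R := (k n)%:R / Num.sqrt n%:R.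
have D0 : 0 < D.
  have h : 0 <= 8 * sigma ^+ 2 by rewrite mulr_ge0// sqr_ge0.
  rewrite /D -addrA ltr_pwDl// addr_ge0// divr_ge0// ?(ltW C10)//.
    by rewrite mulr_ge0// addr_ge0// sqr_ge0.
  by rewrite exprn_ge0// ltW.
(* Together with [1 <= k n + 1 - q], which says [q <= k n], this makes [k n] positive. *)
have q_gt0 : (0 < q)%N by rewrite -(ltr0n R); exact: lt_le_trans alpha_le_q.
have F0M n : dotv (F0 n) (F0 n) <= n%:R * M ^+ 2.
  rewrite dotvE; apply: (@le_trans _ _ (\sum_(i < n) M ^+ 2)); last first.
    by rewrite sumr_const card_ord mulr_natl.
  apply: ler_sum => i _; rewrite !mxE -expr2 -real_normK ?num_real//.
  have := fM (x n i) (x01 n i) => h.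
  by rewrite ler_sqr ?nnegrE ?normr_ge0// (le_trans _ h).
have kpos : \forall n \near \oo, (0 < k n)%N /\ (k n <= n)%N.
  near=> n.
  have [] : [/\ (1 <= k n + 1 - q)%N, \rank (Phi n) = k n & (k n <= n)%N].
    by near: n; exact: k_rank.
  rewrite subn_gt0 addn1 ltnS => qk _ kn; split=> //.
  exact: leq_trans qk.
have t_small e : 0 < e -> \forall n \near \oo, t n <= e.
  move=> e0; near=> n.
  have [k0 kn] : (0 < k n)%N /\ (k n <= n)%N by near: n.
  have n0 : 0 < n%:R :> R by rewrite ltr0n (leq_trans k0).
  have h : (k n)%:R ^+ 2 <= e ^+ 2 * n%:R.
    by near: n; apply: littleo_cbrt_sqr_le => //; rewrite exprn_gt0.
  rewrite ler_pdivrMr ?sqrtr_gt0// -ler_sqr ?nnegrE ?ler0n//; last first.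
    by rewrite mulr_ge0 ?sqrtr_ge0// ltW.
  by rewrite exprMn sqr_sqrtr// ltW.
have modelP : \forall n \near \oo,
  [/\ 0 < C1 * (n%:R / (k n)%:R),
    forall v, C1 * (n%:R / (k n)%:R) * dotv v v <= qform (gram (Phi n)) v,
    0 < t n & tv_bound (k n) (C1 * (n%:R / (k n)%:R)) sigma (F0 n) (t n)
      <= D * t n].
  near=> n.
  have [k0 kn] : (0 < k n)%N /\ (k n <= n)%N by near: n.
  have n0 : 0 < n%:R :> R by rewrite ltr0n (leq_trans k0).
  have K0 : 0 < (k n)%:R :> R by rewrite ltr0n.
  have t0 : 0 < t n by rewrite divr_gt0// sqrtr_gt0.
  split=> //.
  - by rewrite mulr_gt0// divr_gt0.
  - move=> v; rewrite -sqr_enorm.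
    suff /(_ v)/andP[] : forall theta : 'cV[R]_(k n),
       C1 * (n%:R / (k n)%:R) * enorm theta ^+ 2
         <= (theta^T *m gram (Phi n) *m theta) 0 0
         <= C2 * (n%:R / (k n)%:R) * enorm theta ^+ 2 by [].
    by near: n.
  - apply: tv_bound_le => //; first by rewrite exprMn exprVn sqr_sqrtr// ltW.
    by rewrite t0 /=; near: n; exact: t_small.
split.
  apply: cvge0_le => [n|e e0].
    apply: integral_ge0 => y _.
    apply: le_trans (abse_ge0 (W n y set0 - gauss_law (lse (Phi n) (colv y))
      (sigma ^+ 2 *: invmx (gram (Phi n))) set0)%E) _.
    by apply: ereal_sup_ubound; exists set0.
  near=> n.
  have [kap0 kapP t0 tvD] : [/\ 0 < C1 * (n%:R / (k n)%:R),
    forall v, C1 * (n%:R / (k n)%:R) * dotv v v <= qform (gram (Phi n)) v,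
    0 < t n & tv_bound (k n) (C1 * (n%:R / (k n)%:R)) sigma (F0 n) (t n)
      <= D * t n] by near: n.
  have t1 : 0 < t n <= 1 by rewrite t0 /=; near: n; exact: t_small.
  apply: le_trans (expected_tv_le kap0 kapP sigma_gt0 (F0 n) t1) _.
  rewrite lee_fin (le_trans tvD)// mulrC -ler_pdivlMr//.
  by near: n; apply: t_small; rewrite divr_gt0.
move=> lambda lambda_oo.
apply: cvge0_le => [n|e e0].
  apply: integral_ge0 => y _; rewrite lee_fin divr_ge0// Rintegral_ge0// => v _;
    exact: gauss_pdf_ge0.
near=> n.
have [kap0 kapP t0 tvD] : [/\ 0 < C1 * (n%:R / (k n)%:R),
  forall v, C1 * (n%:R / (k n)%:R) * dotv v v <= qform (gram (Phi n)) v,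
  0 < t n & tv_bound (k n) (C1 * (n%:R / (k n)%:R)) sigma (F0 n) (t n)
    <= D * t n] by near: n.
have [k0 kn] : (0 < k n)%N /\ (k n <= n)%N by near: n.
have n0 : 0 < n%:R :> R by rewrite ltr0n (leq_trans k0).
have K0 : 0 < (k n)%:R :> R by rewrite ltr0n.
have t1 : 0 < t n <= 1 by rewrite t0 /=; near: n; exact: t_small.
(* [l1] allows [lambda] to be replaced by its square; [l2] then brings the Markov term
   [32 sigma^2 / (C1 lambda^2)] below [e / 2]. *)
have l1 : 1 <= lambda n by near: n; apply: (cvgryPge _).1.
have l2 : 64 * sigma ^+ 2 / C1 / e <= lambda n by near: n; apply: (cvgryPge _).1.
have l0 : 0 < lambda n by exact: lt_le_trans l1.
have rho0 : 0 < lambda n * t n by rewrite mulr_gt0.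
have := expected_posterior_far_le kap0 kapP sigma_gt0 (F0 n) rho0 t1.
move=> /le_trans; apply; rewrite lee_fin [leRHS]splitr lerD//.
  apply: le_trans tvD _; rewrite mulrC -ler_pdivlMr//.
  by near: n; apply: t_small; rewrite !divr_gt0.
(* Since [s k = sigma^2 t^2 / C1], the rate [t n] cancels and only [lambda n] remains. *)
have -> : (lambda n * t n) ^- 2 *
    (4 * (8 * (sigma ^+ 2 / (C1 * (n%:R / (k n)%:R))) *+ k n)) =
    32 * sigma ^+ 2 / C1 / lambda n ^+ 2.
  rewrite -mulr_natr exprMn.
  have -> : t n ^+ 2 = (k n)%:R ^+ 2 / n%:R.
    by rewrite exprMn exprVn sqr_sqrtr// ltW.
  by field; rewrite !gt_eqF.
rewrite ler_pdivrMr ?exprn_gt0//.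
apply: (@le_trans _ _ (e / 2 * lambda n)); last first.
  by rewrite ler_pM2l ?divr_gt0// expr2 ler_peMr// ltW.
rewrite ler_pdivrMr// -mulrA in l2; rewrite -mulrA.
by move: l2; set a := sigma ^+ 2 / C1; clearbody a; lra.
Unshelve. all: by end_near. Qed.
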